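(* Let $n\ge 3$, let $1<a_2<\cdots<a_n$ be integers, let $A=(1,a_2,\ldots,a_n)$ and let $\beta\in\mathbf{C}$. Then the set of geometric slopes of $\mathcal{H}_A(\beta)$ along $x_n=0$ at the origin of $\mathbf{C}^n$ coincides with the set of geometric slopes of $\mathcal{H}_{(1,a_{n-1},a_n)}(\beta)$ along $x_3=0$ at the origin of $\mathbf{C}^3$ (with coordinates $x_1,x_2,x_3$ corresponding to the entries $1,a_{n-1},a_n$ respectively).
   Context: **GKZ systems.** $A_n=\mathbf{C}\langle x_1,\ldots,x_n,\partial_1,\ldots,\partial_n\rangle$ is the Weyl algebra. For a row $A=(a_1,\ldots,a_n)$ of positive integers, $I_A\subset\mathbf{C}[\partial_1,\ldots,\partial_n]$ is the toric ideal generated by all $\partial^u-\partial^v$ with $u,v\in\mathbf{N}^n$ and $\sum a_iu_i=\sum a_iv_i$. For $\beta\in\mathbf{C}$, $H_A(\beta)$ is the left ideal of $A_n$ generated by $I_A$ and $\sum_{i=1}^n a_ix_i\partial_i-\beta$, and $\mathcal{H}_A(\beta)=A_n/H_A(\beta)$. **Initial ideals.** Let $F=(0,\ldots,0;1,\ldots,1)$ and $V=(0,\ldots,0,-1;0,\ldots,0,1)$ in $\mathbf{R}^{2n}$, viewed as weights on $(x_1,\ldots,x_n;\partial_1,\ldots,\partial_n)$: $F$ gives weight $0$ to each $x_i$ and $1$ to each $\partial_i$; $V$ gives weight $-1$ to $x_n$, $1$ to $\partial_n$ and $0$ to all other variables. For $p>0$, $q\ge 0$ put $L=pF+qV$. For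 nonzero $P=\sum p_{\alpha\beta}x^\alpha\partial^\beta\in A_n$, $\mathrm{in}_L(P)=\sum p_{\alpha\beta}x^\alpha\xi^\beta\in\mathbf{C}[x_1,\ldots,x_n,\xi_1,\ldots,\xi_n]$, where the sum is over the terms of maximal $L$-weight. For a left ideal $I\subset A_n$, $\mathrm{in}_L(I)$ is the ideal generated by all $\mathrm{in}_L(P)$, $P\in I\setminus\{0\}$. **Geometric slopes.** Let $\sigma^L(I)$ be the ideal generated by $\mathrm{in}_L(I)$ in $\mathbf{C}\{x_1,\ldots,x_{n-1}\}[x_n,\xi_1,\ldots,\xi_n]$, where $\mathbf{C}\{\cdot\}$ denotes convergent power series at the origin. (This is the ring of germs at the origin of $\mathrm{gr}^L(\mathcal{D})$, $\mathcal{D}$ being the sheaf of holomorphic differential operators, up to renaming variables.) This ring is graded by $F$ and by $V$ (the variables $x_1,\ldots,x_{n-1}$ have degree $0$ for both; $\xi_i$ gets the weight of $\partial_i$). A real number $r$ with $-\infty<r<0$ is a geometric slope of $A_n/I$ along $x_n=0$ at the origin if, for $L=(-r)F+V$, the radical $\sqrt{\sigma^L(I)}$ is not bihomogeneous, i.e. not homogeneous with respect to both the $F$-grading and the $V$-grading. *)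

(* Defs.v *)
From HB Require Import structures.
From mathcomp Require Import all_boot all_order all_algebra.
From mathcomp Require Import boolp classical_sets reals.
From mathcomp Require Import complex ssrcomplements mpoly.

Set Implicit Arguments.
Unset Strict Implicit.
Unset Printing Implicit Defensive.

Import Order.TTheory GRing.Theory Num.Theory.
Local Open Scope ring_scope.
Local Open Scope classical_set_scope.

Section Weyl.
Variables (n : nat) (K : comNzRingType).
Implicit Types (p q : {mpoly K[n + n]}) (m : 'X_{1..n + n}).

(* Elements of the Weyl algebra are represented by their normally ordered
   expression sum p_(a,b) x^a d^b, that is by the polynomial
   sum p_(a,b) x^a xi^b in the n + n variables x_i = 'X_(lshift n i) and
   xi_i = 'X_(rshift n i).  Since d_i x_i = x_i d_i + 1, left multiplication by
   d_i sends the normal form q to xi_i q + dq/dx_i. *)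
Definition dmul (i : 'I_n) q : {mpoly K[n + n]} :=
  'X_(rshift n i) * q + q^`M(lshift n i).

(* Left multiplication by d^b and the monomial x^a, where m = (a, b). *)
Definition dmulm m q : {mpoly K[n + n]} :=
  foldr (fun i => iter (m (rshift n i)) (dmul i)) q (enum 'I_n).

Definition xmon m : {mpoly K[n + n]} :=
  \prod_(i < n) 'X_(lshift n i) ^+ m (lshift n i).

Definition nmul p q : {mpoly K[n + n]} :=
  \sum_(m <- msupp p) p@_m *: (xmon m * dmulm m q).

Lemma nmulwE p q k : (msize p <= k)%N ->
  nmul p q = \sum_(m : 'X_{1..(n + n) < k}) p@_m *: (xmon m * dmulm m q).
Proof.
move=> le_pk; rewrite /nmul (big_mksub ('X_{1..(n + n) < k} : subFinType _)) ?msupp_uniq //=; last first.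
  by move=> x /msize_mdeg_lt/leq_trans; apply.
by rewrite big_rmcond //= => j /memN_msupp_eq0 ->; rewrite scale0r.
Qed.

Lemma nmulDl p1 p2 q : nmul (p1 + p2) q = nmul p1 q + nmul p2 q.
Proof.
pose k := maxn (msize (p1 + p2)) (maxn (msize p1) (msize p2)).
rewrite !(@nmulwE _ _ k) ?leq_max ?leqnn ?orbT // -big_split.
by apply: eq_bigr => m _; rewrite mcoeffD scalerDl.
Qed.

Lemma nmulZl c p q : nmul (c *: p) q = c *: nmul p q.
Proof.
pose k := maxn (msize (c *: p)) (msize p).
rewrite !(@nmulwE _ _ k) ?leq_max ?leqnn ?orbT // scaler_sumr.
by apply: eq_bigr => m _; rewrite mcoeffZ scalerA.
Qed.

Lemma nmul0l q : nmul 0 q = 0.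
Proof. by rewrite -[X in nmul X](scale0r 0) nmulZl scale0r. Qed.

Lemma nmulXl m q : nmul 'X_[m] q = xmon m * dmulm m q.
Proof. by rewrite /nmul msuppX big_seq1 mcoeffX eqxx scale1r. Qed.

Fact dmul_is_linear i : linear (dmul i).
Proof.
move=> c p q; rewrite /dmul linearP mulrDr -scalerAr scalerDr -!addrA.
by congr (_ + _); rewrite addrCA.
Qed.
HB.instance Definition _ i := GRing.isLinear.Build K {mpoly K[n + n]}
  {mpoly K[n + n]} _ (dmul i) (dmul_is_linear i).

Lemma iter_dmul_linear i j : linear (iter j (dmul i)).
Proof. by elim: j => [//|j IH] c p q /=; rewrite IH linearP. Qed.

Lemma dmulm_linear m : linear (dmulm m).
Proof.
rewrite /dmulm => c p q; elim: (enum 'I_n) => //= i s ->.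
exact: iter_dmul_linear.
Qed.
HB.instance Definition _ m := GRing.isLinear.Build K {mpoly K[n + n]}
  {mpoly K[n + n]} _ (dmulm m) (dmulm_linear m).

Lemma nmulDr p q1 q2 : nmul p (q1 + q2) = nmul p q1 + nmul p q2.
Proof.
rewrite /nmul -big_split; apply: eq_bigr => m _.
by rewrite linearD mulrDr scalerDr.
Qed.

Lemma nmulZr p c q : nmul p (c *: q) = c *: nmul p q.
Proof.
rewrite /nmul scaler_sumr; apply: eq_bigr => m _.
by rewrite linearZ /= -scalerAr !scalerA mulrC.
Qed.

Lemma dmulC i j q : dmul i (dmul j q) = dmul j (dmul i q).
Proof.
rewrite /dmul !mderivD !mderivM !mderivX !mnm1E !eq_rlshift !scale0r !mul0r.
rewrite !add0r !mulrDr [_ ^`M(_)^`M(_)]mderiv_comm !mulrA.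
rewrite [X in X * q]mulrC -!addrA; congr (_ + _).
by rewrite !addrA; congr (_ + _); rewrite addrC.
Qed.

Lemma iter_dmulC i j k q : iter k (dmul j) (dmul i q) = dmul i (iter k (dmul j) q).
Proof. by elim: k => //= k ->; rewrite dmulC. Qed.

Lemma dmulmD m i q : dmulm (m + U_(rshift n i))%MM q = dmul i (dmulm m q).
Proof.
rewrite /dmulm; have : i \in enum 'I_n by rewrite mem_enum.
have := enum_uniq 'I_n; elim: (enum 'I_n) => //= j s IH /andP[js us].
rewrite inE mnmDE mnm1E eq_rshift; case: eqVneq js => [<-|ij] js /=.
  move=> _; rewrite addn1 iterS; congr (dmul i (iter _ _ _)).
  elim: s js {IH us} => //= k s IH; rewrite inE negb_or => /andP[ik /IH ->].
  by rewrite mnmDE mnm1E eq_rshift (negbTE ik) addn0.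
by move=> {}/IH -> //; rewrite addn0 iter_dmulC.
Qed.

Lemma dmulm_eq m m' q : (forall i, m (rshift n i) = m' (rshift n i)) ->
  dmulm m q = dmulm m' q.
Proof. by move=> e; rewrite /dmulm; elim: (enum 'I_n) => //= i s ->; rewrite e. Qed.

Lemma xmon_eq m m' : (forall i, m (lshift n i) = m' (lshift n i)) ->
  xmon m = xmon m'.
Proof. by move=> e; apply: eq_bigr => i _; rewrite e. Qed.

Lemma xmonD m m' : xmon (m + m')%MM = xmon m * xmon m'.
Proof. by rewrite -big_split; apply: eq_bigr => i _; rewrite mnmDE exprD. Qed.

Lemma xmonl i : xmon U_(lshift n i)%MM = 'X_(lshift n i).
Proof.
rewrite /xmon (bigD1 i) //= mnm1E eqxx expr1 big1 ?mulr1 // => j ji.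
by rewrite mnm1E eq_lshift eq_sym (negbTE ji) expr0.
Qed.

Lemma xmonXE m : xmon m = 'X_[[multinom if split i is inl _ then m i else 0 | i < n + n]].
Proof.
rewrite [RHS]mpolyXE_id big_split_ord /= [X in _ = _ * X]big1 ?mulr1.
  by apply: eq_bigr => i _; rewrite mnmE (unsplitK (inl i)).
by move=> i _; rewrite mnmE (unsplitK (inr i)) expr0.
Qed.

Lemma mderiv_xmon i m :
  (xmon m)^`M(lshift n i) = (m (lshift n i))%:R *: xmon (m - U_(lshift n i))%MM.
Proof.
rewrite !xmonXE mderivX mnmE (unsplitK (inl i)); congr (_ *: 'X_[_]).
apply/mnmP => j; rewrite mnmBE !mnmE; case: splitP => // k jk.
Qed.

Lemma dmul_xmon i m q : dmul i (xmon m * q) =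
  xmon m * dmul i q + (m (lshift n i))%:R *: (xmon (m - U_(lshift n i))%MM * q).
Proof.
rewrite /dmul mderivM mderiv_xmon mulrDr mulrCA -scalerAl -!addrA.
by congr (_ + _); rewrite addrC.
Qed.

Lemma nmul_xl i p q : nmul ('X_(lshift n i) * p) q = 'X_(lshift n i) * nmul p q.
Proof.
elim/mpolyind: p => [|c m p _ _ IH]; first by rewrite mulr0 nmul0l mulr0.
rewrite mulrDr !nmulDl IH mulrDr -scalerAr !nmulZl -scalerAr -mpolyXD !nmulXl.
rewrite xmonD xmonl mulrA; congr (_ + _); congr (_ *: (_ * _)).
by apply: dmulm_eq => j; rewrite mnmDE mnm1E eq_lrshift.
Qed.

Lemma nmul_dl i p q : nmul (dmul i p) q = dmul i (nmul p q).
Proof.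
elim/mpolyind: p => [|c m p _ _ IH]; first by rewrite linear0 !nmul0l linear0.
rewrite dmul_is_linear nmulDl IH [nmul (_ + p) q]nmulDl !nmulZl dmul_is_linear; congr (_ *: _ + _).
rewrite {1}/dmul mderivX -mpolyXD nmulDl nmulZl !nmulXl dmul_xmon.
rewrite addmC dmulmD; congr (_ * _ + _ *: (_ * _)).
  by apply: xmon_eq => j; rewrite mnmDE mnm1E eq_rlshift addn0.
by apply: dmulm_eq => j; rewrite mnmBE mnm1E eq_lrshift subn0.
Qed.

Lemma nmul_dlm m p q : nmul (dmulm m p) q = dmulm m (nmul p q).
Proof.
rewrite /dmulm; elim: (enum 'I_n) => //= i s <-.
by elim: (m _) => //= k <-; rewrite nmul_dl.
Qed.

Lemma nmul_xml m p q : nmul (xmon m * p) q = xmon m * nmul p q.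
Proof.
rewrite /xmon; elim: (index_enum _) => [|i s IH]; first by rewrite big_nil !mul1r.
rewrite !big_cons -!mulrA -IH; elim: (m _) => [|k IHk]; first by rewrite !mul1r.
by rewrite !exprS -!mulrA nmul_xl IHk.
Qed.

Lemma nmulA : associative nmul.
Proof.
move=> p q r; elim/mpolyind: p => [|c m p _ _ IH]; first by rewrite !nmul0l.
by rewrite !nmulDl -IH !nmulZl !nmulXl nmul_xml nmul_dlm.
Qed.

Lemma nmul1l : left_id 1 nmul.
Proof.
move=> q; rewrite -mpolyX0 nmulXl /xmon big1 ?mul1r; last first.
  by move=> i _; rewrite mnm0E.
by rewrite /dmulm; elim: (enum 'I_n) => //= i s ->; rewrite mnm0E.
Qed.

Lemma dmulm1 m : dmulm m 1 = \prod_(i < n) 'X_(rshift n i) ^+ m (rshift n i).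
Proof.
rewrite -big_enum /dmulm /=.
have: forall i, ((1 : {mpoly K[n + n]})^`M(lshift n i)) = 0 by move=> i; exact: mderivC.
suff H s : foldr (fun i => iter (m (rshift n i)) (dmul i)) 1 s =
    \prod_(i <- s) 'X_(rshift n i) ^+ m (rshift n i) /\
    forall i, (\prod_(i <- s) ('X_(rshift n i) : {mpoly K[n + n]}) ^+ m (rshift n i))^`M(lshift n i) = 0.
  by rewrite (H _).1.
elim: s => [|i s [IH1 IH2]] /=; first by rewrite !big_nil; split=> // i; exact: mderivC.
rewrite IH1 !big_cons; move: (\prod_(_ <- _) _) IH2 => Q HQ; elim: (m _) => [|k [IH3 IH4]].
  by rewrite !mul1r.
rewrite iterS IH3 !exprS; split=> [|j].
  by rewrite /dmul IH4 addr0 mulrA.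
by rewrite -mulrA mderivM IH4 mulr0 mderivX mnm1E eq_rlshift scale0r mul0r addr0.
Qed.

Lemma nmul1r : right_id 1 nmul.
Proof.
move=> p; rewrite /nmul [RHS]mpolyE; apply: eq_bigr => m _.
by rewrite dmulm1 [in RHS]mpolyXE_id big_split_ord.
Qed.

Record weyl := Weyl { symb : {mpoly K[n + n]} }.
HB.instance Definition _ := [isNew for symb].
HB.instance Definition _ := [Choice of weyl by <:].

Definition weyl_add P Q := Weyl (symb P + symb Q).
Definition weyl_opp P := Weyl (- symb P).
Definition weyl_mul P Q := Weyl (nmul (symb P) (symb Q)).

Fact weyl_addA : associative weyl_add.
Proof. by move=> P Q S; congr Weyl; rewrite addrA. Qed.
Fact weyl_addC : commutative weyl_add.
Proof. by move=> P Q; congr Weyl; rewrite addrC. Qed.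
Fact weyl_add0 : left_id (Weyl 0) weyl_add.
Proof. by case=> p; congr Weyl; rewrite add0r. Qed.
Fact weyl_addN : left_inverse (Weyl 0) weyl_opp weyl_add.
Proof. by move=> P; congr Weyl; rewrite addNr. Qed.
HB.instance Definition _ :=
  GRing.isZmodule.Build weyl weyl_addA weyl_addC weyl_add0 weyl_addN.

Fact weyl_mulA : associative weyl_mul.
Proof. by move=> P Q S; congr Weyl; rewrite nmulA. Qed.
Fact weyl_mul1l : left_id (Weyl 1) weyl_mul.
Proof. by case=> p; congr Weyl; rewrite nmul1l. Qed.
Fact weyl_mul1r : right_id (Weyl 1) weyl_mul.
Proof. by case=> p; congr Weyl; rewrite nmul1r. Qed.
Fact weyl_mulDl : left_distributive weyl_mul +%R.
Proof. by move=> P Q S; congr Weyl; rewrite nmulDl. Qed.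
Fact weyl_mulDr : right_distributive weyl_mul +%R.
Proof. by move=> P Q S; congr Weyl; rewrite nmulDr. Qed.
Fact weyl_oner_neq0 : Weyl 1 != 0.
Proof. by rewrite -val_eqE /= oner_eq0. Qed.
HB.instance Definition _ := GRing.Zmodule_isNzRing.Build weyl
  weyl_mulA weyl_mul1l weyl_mul1r weyl_mulDl weyl_mulDr weyl_oner_neq0.

Definition wC (c : K) : weyl := Weyl c%:MP.
Definition wx (i : 'I_n) : weyl := Weyl 'X_(lshift n i).
Definition wd (i : 'I_n) : weyl := Weyl 'X_(rshift n i).

Fact wC_is_zmod : zmod_morphism wC.
Proof. by move=> c d; congr Weyl; rewrite mpolyCB. Qed.
HB.instance Definition _ := GRing.isZmodMorphism.Build K weyl wC wC_is_zmod.

Fact wC_is_monoid : monoid_morphism wC.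
Proof.
split=> // c d; congr Weyl => /=.
by rewrite -[c%:MP in RHS]mulr1 mul_mpolyC nmulZl nmul1l mpolyCM mul_mpolyC.
Qed.
HB.instance Definition _ := GRing.isMonoidMorphism.Build K weyl wC wC_is_monoid.

(* wx_comm, wd_comm, wd_wx and weyl_normalE characterize weyl: it satisfies the
   Weyl relations and the x^a d^b form a K-basis. *)
Lemma wx_comm i j : wx i * wx j = wx j * wx i.
Proof.
apply: val_inj; rewrite /= -['X_(lshift n j)]mulr1 -['X_(lshift n i)]mulr1.
by rewrite !nmul_xl !nmul1l mulrCA.
Qed.

Lemma symb_wd_mul i P : symb (wd i * P) = dmul i (symb P).
Proof.
have -> : symb (wd i * P) = nmul (dmul i 1) (symb P).
  by rewrite /dmul mulr1 mderivC addr0.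
by rewrite nmul_dl nmul1l.
Qed.

Lemma symb_wx_mul i P : symb (wx i * P) = 'X_(lshift n i) * symb P.
Proof.
have -> : symb (wx i * P) = nmul ('X_(lshift n i) * 1) (symb P) by rewrite mulr1.
by rewrite nmul_xl nmul1l.
Qed.

Lemma wd_comm i j : wd i * wd j = wd j * wd i.
Proof.
apply: val_inj; rewrite -[LHS]/(symb (wd i * wd j)) -[RHS]/(symb (wd j * wd i)).
by rewrite -[wd j in LHS]mulr1 -[wd i in RHS]mulr1 !symb_wd_mul dmulC.
Qed.

Lemma symb_nat k : symb k%:R = k%:R.
Proof. by elim: k => // k IH; rewrite -!natr1 -IH. Qed.

Lemma wd_wx i j : wd i * wx j = wx j * wd i + (i == j)%:R.
Proof.
apply: val_inj => /=.
rewrite -[RHS]/(symb (wx j * wd i) + symb (i == j)%:R) symb_wx_mul symb_nat.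
rewrite -[LHS]/(symb (wd i * wx j)) symb_wd_mul /dmul mulrC mderivX mnm1E eq_lshift.
rewrite [i == j]eq_sym; congr (_ + _); case: eqP => [->|]; last by rewrite scale0r.
by rewrite scale1r -[X in (X - _)%MM]add0m addmK mpolyX0.
Qed.

Lemma weyl_normalE (P : weyl) : P = \sum_(m <- msupp (symb P))
  wC (symb P)@_m * (\prod_(i < n) wx i ^+ m (lshift n i))
                 * (\prod_(i < n) wd i ^+ m (rshift n i)).
Proof.
have sD : {morph symb : Q S / Q + S} by [].
apply: val_inj; rewrite /= (big_morph _ sD (erefl : symb 0 = 0)) {1}[symb P]mpolyE.
apply: eq_bigr => m _.
have Cm c Q : symb (wC c * Q) = c *: symb Q.
  by rewrite /= -[c%:MP]mulr1 mul_mpolyC nmulZl nmul1l.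
have xm Q : symb ((\prod_(i < n) wx i ^+ m (lshift n i)) * Q) = xmon m * symb Q.
  rewrite /xmon; elim: (index_enum _) => [|i s IH]; first by rewrite !big_nil !mul1r.
  rewrite !big_cons -!mulrA -IH; elim: (m _) => [|k IHk]; first by rewrite !mul1r.
  by rewrite !exprS -!mulrA symb_wx_mul IHk.
have dm : symb (\prod_(i < n) wd i ^+ m (rshift n i)) = dmulm m 1.
  have -> : index_enum 'I_n = enum 'I_n by rewrite enumT /index_enum; case: index_enum_key.
  rewrite /dmulm; elim: (enum 'I_n) => [|i s IH]; first by rewrite big_nil.
  rewrite big_cons [RHS]/= -IH; elim: (m _) => [|k IHk]; first by rewrite expr0 mul1r.
  by rewrite exprS -mulrA symb_wd_mul IHk.
rewrite -mulrA Cm xm dm dmulm1 [in LHS]mpolyXE_id big_split_ord.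
by [].
Qed.

End Weyl.

Section ConvergentSeries.
Variables (n : nat) (K : numFieldType).
Implicit Types (f g : 'X_{1..n} -> K) (m : 'X_{1..n}).

(* The modulus of a complex number is itself an element of R[i]; for r in R[i],
   0 < r means that r is real and positive.  A series converges if it converges
   absolutely at some point (r, ..., r) with r > 0. *)
Definition abs_sum f (r : K) (d : nat) : K :=
  \sum_(m : 'X_{1..n < d}) `|f m| * r ^+ mdeg m.

Definition convergent f : Prop :=
  exists2 r : K, 0 < r & exists M : K, forall d, abs_sum f r d <= M.

Record cseries := CSeries { scoef :> 'X_{1..n} -> K; _ : `[< convergent scoef >] }.
HB.instance Definition _ := [isSub for scoef].
HB.instance Definition _ := [Choice of cseries by <:].

Lemma cseriesP (f : cseries) : convergent f.
Proof. by case: f => f /= /asboolP. Qed.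

Definition mkcseries f (cf : convergent f) : cseries := CSeries (asboolT cf).

Lemma cseries_ext (f g : cseries) : f =1 g -> f = g.
Proof. by move=> fg; apply/val_inj/funext. Qed.

Lemma abs_sum_le f (r s : K) d : 0 <= r -> r <= s -> abs_sum f r d <= abs_sum f s d.
Proof.
move=> r0 rs; apply: ler_sum => m _; rewrite ler_wpM2l //.
by rewrite lerXn2r // ?nnegrE // (le_trans r0).
Qed.

Lemma convergent2 f g : convergent f -> convergent g -> exists2 r : K, 0 < r &
  exists M : K, forall d, abs_sum f r d <= M /\ abs_sum g r d <= M.
Proof.
move=> [r r0 [M fM]] [s s0 [N gN]].
have M0 : 0 <= M by apply: le_trans (fM 0%N); rewrite sumr_ge0 // => m _; rewrite mulr_ge0 // exprn_ge0 // ltW.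
have N0 : 0 <= N by apply: le_trans (gN 0%N); rewrite sumr_ge0 // => m _; rewrite mulr_ge0 // exprn_ge0 // ltW.
have t0 : 0 < r * s / (r + s) by rewrite divr_gt0 ?mulr_gt0 ?addr_gt0.
exists (r * s / (r + s)) => //; exists (M + N) => d; split.
  apply: le_trans (le_trans (fM d) _); last by rewrite lerDl.
  apply: abs_sum_le; first exact: ltW.
  by rewrite ler_pdivrMr ?addr_gt0 // ler_wpM2l ?lerDr // ltW.
apply: le_trans (le_trans (gN d) _); last by rewrite lerDr.
apply: abs_sum_le; first exact: ltW.
by rewrite ler_pdivrMr ?addr_gt0 // mulrC ler_wpM2l ?lerDl // ltW.
Qed.

(* Cauchy product, in the form of mcoeffM. *)
Definition conv_mul f g m : K :=
  \sum_(k : 'X_{1..n < (mdeg m).+1, (mdeg m).+1} | m == (k.1 + k.2)%MM) f k.1 * g k.2.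

Definition trunc f d : {mpoly K[n]} := \sum_(m : 'X_{1..n < d}) f m *: 'X_[m].

Lemma mcoeff_trunc f d m : (mdeg m < d)%N -> (trunc f d)@_m = f m.
Proof. exact: mcoeff_mpoly. Qed.

Lemma mcoeff_mul_eq (p q p' q' : {mpoly K[n]}) m :
  (forall k, (mdeg k <= mdeg m)%N -> p@_k = p'@_k) ->
  (forall k, (mdeg k <= mdeg m)%N -> q@_k = q'@_k) ->
  (p * q)@_m = (p' * q')@_m.
Proof.
move=> pp qq; rewrite !mcoeffM; apply: eq_bigr => -[[a /= am] [b /= bm]] _.
by rewrite pp ?qq.
Qed.

Lemma conv_mulE f g (p q : {mpoly K[n]}) m :
  (forall k, (mdeg k <= mdeg m)%N -> p@_k = f k) ->
  (forall k, (mdeg k <= mdeg m)%N -> q@_k = g k) ->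
  conv_mul f g m = (p * q)@_m.
Proof.
move=> pf qg; rewrite mcoeffM; apply: eq_bigr => -[[a /= am] [b /= bm]] _.
by rewrite pf ?qg.
Qed.

Lemma conv_mul_trunc f g d m : (mdeg m < d)%N ->
  conv_mul f g m = (trunc f d * trunc g d)@_m.
Proof. by move=> md; apply: conv_mulE => k km; rewrite mcoeff_trunc // (leq_ltn_trans km). Qed.

Lemma sum_bmnm_le d (a : 'X_{1..n}) (x : K) : 0 <= x ->
  \sum_(m : 'X_{1..n < d} | bmnm m == a) x <= x.
Proof.
move=> x0; have [ad|da] := ltnP (mdeg a) d.
  by rewrite (big_pred1 (BMultinom ad)).
rewrite big_pred0 // => m; apply/eqP => ma; have := bmdeg m.
by rewrite ma ltnNge da.
Qed.

Lemma abs_sum_mul f g (r : K) d : 0 <= r ->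
  abs_sum (conv_mul f g) r d <= abs_sum f r d * abs_sum g r d.
Proof.
move=> r0; rewrite /abs_sum big_distrlr /=.
pose F (k : 'X_{1..n < d, d}) := `|f k.1| * r ^+ mdeg k.1 * (`|g k.2| * r ^+ mdeg k.2).
have F0 k : 0 <= F k by rewrite /F !mulr_ge0 ?exprn_ge0.
rewrite pair_bigA /= -/(\sum_k F k).
apply: (@le_trans _ _ (\sum_(m : 'X_{1..n < d})
    \sum_(k : 'X_{1..n < d, d} | bmnm m == (k.1 + k.2)%MM) F k)); last first.
  rewrite (exchange_big_dep xpredT) //=; apply: ler_sum => k _.
  exact: sum_bmnm_le.
apply: ler_sum => m _; rewrite (conv_mul_trunc _ _ (bmdeg m)).
rewrite (mcoeff_poly_mul _ _ (bmdeg m)).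
apply: le_trans (ler_wpM2r _ (ler_norm_sum _ _ _)) _; first exact: exprn_ge0.
rewrite mulr_suml; apply: ler_sum => k /eqP mk.
rewrite !mcoeff_trunc ?bmdeg // normrM mk mdegD exprD /F.
by rewrite mulrACA.
Qed.

Fact convergent_mul f g : convergent f -> convergent g -> convergent (conv_mul f g).
Proof.
move=> cf cg; have [r r0 [M fgM]] := convergent2 cf cg; exists r => //.
exists (M * M) => d; have [fM gM] := fgM d.
apply: le_trans (abs_sum_mul _ _ _ (ltW r0)) _.
by rewrite ler_pM // sumr_ge0 // => m _; rewrite mulr_ge0 // exprn_ge0 // ltW.
Qed.

Fact convergent_add f g : convergent f -> convergent g -> convergent (fun m => f m + g m).
Proof.
move=> cf cg; have [r r0 [M fgM]] := convergent2 cf cg; exists r => //.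
exists (M + M) => d; have [fM gM] := fgM d; apply: le_trans (lerD fM gM).
rewrite -big_split; apply: ler_sum => m _ /=.
by rewrite -mulrDl ler_wpM2r ?ler_normD // exprn_ge0 // ltW.
Qed.

Fact convergent_opp f : convergent f -> convergent (fun m => - f m).
Proof.
move=> [r r0 [M fM]]; exists r => //; exists M => d; apply: le_trans (fM d).
by apply: ler_sum => m _; rewrite normrN.
Qed.

Fact convergent_mpoly (p : {mpoly K[n]}) : convergent (fun m => p@_m).
Proof.
elim/mpolyind: p => [|c a p _ _ cp].
  exists 1 => //; exists 0 => d; rewrite /abs_sum big1 // => m _.
  by rewrite mcoeff0 normr0 mul0r.
rewrite [X in convergent X](_ : _ = fun m => (c *: 'X_[a])@_m + p@_m); last first.
  by apply/funext => m; rewrite mcoeffD.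
apply: convergent_add => //; exists 1 => //; exists `|c| => d.
rewrite /abs_sum (bigID (fun m : 'X_{1..n < d} => bmnm m == a)) /=.
rewrite [X in _ + X]big1 ?addr0 => [|m ma]; last first.
  by rewrite mcoeffZ mcoeffX eq_sym (negbTE ma) mulr0 normr0 mul0r.
rewrite (eq_bigr (fun=> `|c|)) ?sum_bmnm_le // => m /eqP ->.
by rewrite mcoeffZ mcoeffX eqxx mulr1 expr1n mulr1.
Qed.

Definition cpoly (p : {mpoly K[n]}) : cseries := mkcseries (convergent_mpoly p).
Definition cadd (f g : cseries) : cseries :=
  mkcseries (convergent_add (cseriesP f) (cseriesP g)).
Definition copp (f : cseries) : cseries := mkcseries (convergent_opp (cseriesP f)).
Definition cmul (f g : cseries) : cseries :=
  mkcseries (convergent_mul (cseriesP f) (cseriesP g)).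

Fact caddA : associative cadd.
Proof. by move=> f g h; apply: cseries_ext => m /=; rewrite addrA. Qed.
Fact caddC : commutative cadd.
Proof. by move=> f g; apply: cseries_ext => m /=; rewrite addrC. Qed.
Fact cadd0 : left_id (cpoly 0) cadd.
Proof. by move=> f; apply: cseries_ext => m /=; rewrite mcoeff0 add0r. Qed.
Fact caddN : left_inverse (cpoly 0) copp cadd.
Proof. by move=> f; apply: cseries_ext => m /=; rewrite mcoeff0 addNr. Qed.
HB.instance Definition _ := GRing.isZmodule.Build cseries caddA caddC cadd0 caddN.

Fact cmulA : associative cmul.
Proof.
move=> f g h; apply: cseries_ext => m /=; pose T (u : cseries) := trunc u (mdeg m).+1.
have TE (u : cseries) k : (mdeg k <= mdeg m)%N -> (T u)@_k = u k by move=> km; rewrite mcoeff_trunc.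
have TM (u v : cseries) k : (mdeg k <= mdeg m)%N -> (T u * T v)@_k = conv_mul u v k.
  by move=> km; rewrite (@conv_mul_trunc _ _ (mdeg m).+1).
rewrite (@conv_mulE _ _ (T f) (T g * T h)); [|exact: TE|exact: TM].
by rewrite mulrA -(@conv_mulE (conv_mul f g) h); [|exact: TM|exact: TE].
Qed.

Fact cmulC : commutative cmul.
Proof.
move=> f g; apply: cseries_ext => m /=.
by rewrite !(@conv_mul_trunc _ _ (mdeg m).+1) // mulrC.
Qed.

Fact cmul1 : left_id (cpoly 1) cmul.
Proof.
move=> f; apply: cseries_ext => m /=.
rewrite (@conv_mulE _ _ 1 (trunc f (mdeg m).+1)) // => [|k km].
  by rewrite mul1r mcoeff_trunc.
by rewrite mcoeff_trunc.
Qed.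

Fact cmulDl : left_distributive cmul +%R.
Proof.
move=> f g h; apply: cseries_ext => m /=; rewrite -big_split /=.
by apply: eq_bigr => k _; rewrite mulrDl.
Qed.

Fact cone_neq0 : cpoly 1 != 0.
Proof.
apply/eqP => /(congr1 (fun f : cseries => f 0%MM)) /=.
by rewrite mcoeff0 mcoeff1 eqxx => /eqP; rewrite oner_eq0.
Qed.

HB.instance Definition _ := GRing.Zmodule_isComNzRing.Build cseries
  cmulA cmulC cmul1 cmulDl cone_neq0.

Fact cpoly_is_zmod : zmod_morphism cpoly.
Proof. by move=> p q; apply: cseries_ext => m /=; rewrite mcoeffB. Qed.
HB.instance Definition _ :=
  GRing.isZmodMorphism.Build {mpoly K[n]} cseries cpoly cpoly_is_zmod.

Fact cpoly_is_monoid : monoid_morphism cpoly.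
Proof.
by split=> // p q; apply: cseries_ext => m /=; rewrite (@conv_mulE _ _ p q).
Qed.
HB.instance Definition _ :=
  GRing.isMonoidMorphism.Build {mpoly K[n]} cseries cpoly cpoly_is_monoid.

End ConvergentSeries.

Section Ideals.

Definition left_ideal (S : nzRingType) (J : set S) : Prop :=
  [/\ J 0, forall a b, J a -> J b -> J (a + b) & forall a b, J b -> J (a * b)].

Definition ideal_gen (S : nzRingType) (G : set S) : set S :=
  smallest (@left_ideal S) G.

Definition radical (S : comNzRingType) (J : set S) : set S :=
  [set f | exists k, J (f ^+ k)].

End Ideals.

Section Gradings.
Variables (k : nat) (S : comNzRingType).

Definition wdeg (w : 'I_k -> int) (m : 'X_{1..k}) : int :=
  \sum_(i < k) w i * (m i)%:Z.

Definition homog_part (w : 'I_k -> int) (d : int) (f : {mpoly S[k]}) : {mpoly S[k]} :=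
  \sum_(m <- msupp f | wdeg w m == d) f@_m *: 'X_[m].

Definition homogeneous (w : 'I_k -> int) (J : set {mpoly S[k]}) : Prop :=
  forall f d, J f -> J (homog_part w d f).

End Gradings.

Section GKZ.
Variables (n : nat) (K : comNzRingType) (A : n.-tuple nat).

Definition Adeg (u : 'X_{1..n}) : nat := (\sum_(i < n) tnth A i * u i)%N.

Definition toric_ideal : set {mpoly K[n]} :=
  ideal_gen [set p | exists u v, Adeg u = Adeg v /\ p = 'X_[u] - 'X_[v]].

(* p(d_1, ..., d_n) *)
Definition diffop (p : {mpoly K[n]}) : weyl n K := mmap (@wC n K) (@wd n K) p.

Definition euler (beta : K) : weyl n K :=
  \sum_(i < n) (tnth A i)%:R * wx K i * wd K i - wC n beta.

Definition GKZ_ideal (beta : K) : set (weyl n K) :=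
  ideal_gen ((diffop @` toric_ideal) `|` [set euler beta]).

End GKZ.

(* From here on the number of variables is n.+1, the last one has index ord_max,
   and the hyperplane is the zero set of x_(ord_max). *)
Section Slopes.
Variables (R : realType) (n : nat).
Local Notation C := R[i].

Definition weightF (i : 'I_(n.+1 + n.+1)) : int :=
  match split i with inl _ => 0 | inr _ => 1 end.

Definition weightV (i : 'I_(n.+1 + n.+1)) : int :=
  match split i with
  | inl j => if j == ord_max then -1 else 0
  | inr j => if j == ord_max then 1 else 0
  end.

Definition Lweight (p q : R) (m : 'X_{1..n.+1 + n.+1}) : R :=
  p * (wdeg weightF m)%:~R + q * (wdeg weightV m)%:~R.

Definition initial_form (p q : R) (P : weyl n.+1 C) : {mpoly C[n.+1 + n.+1]} :=
  let s := msupp (symb P) in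
  \sum_(m <- s | all (fun m' => Lweight p q m' <= Lweight p q m) s)
     (symb P)@_m *: 'X_[m].

Definition initial_ideal (p q : R) (I : set (weyl n.+1 C)) :
    set {mpoly C[n.+1 + n.+1]} :=
  ideal_gen [set initial_form p q P | P in [set P | I P /\ P != 0]].

(* C{x_1, ..., x_n}[x_(n+1), xi_1, ..., xi_(n+1)]: the first of the 1 + n.+1
   polynomial variables is x_(n+1), the others are the xi_i. *)
Definition germ_ring : comNzRingType := {mpoly (cseries n C)[1 + n.+1]}.

Definition germ_of_var (i : 'I_(n.+1 + n.+1)) : germ_ring :=
  match split i with
  | inl j => if unlift ord_max j is Some k then (cpoly 'X_k)%:MP
             else 'X_(lshift n.+1 ord0)
  | inr j => 'X_(rshift 1 j)
  end.

Definition to_germ : {mpoly C[n.+1 + n.+1]} -> germ_ring :=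
  mmap (fun c : C => (cpoly c%:MP)%:MP) germ_of_var.

Definition sigma (p q : R) (I : set (weyl n.+1 C)) : set germ_ring :=
  ideal_gen (to_germ @` initial_ideal p q I).

Definition var_of_germ (i : 'I_(1 + n.+1)) : 'I_(n.+1 + n.+1) :=
  match split i with
  | inl _ => lshift n.+1 ord_max
  | inr j => rshift n.+1 j
  end.

Definition bihomogeneous (J : set germ_ring) : Prop :=
  homogeneous (weightF \o var_of_germ) J /\ homogeneous (weightV \o var_of_germ) J.

Definition geometric_slopes (I : set (weyl n.+1 C)) : set R :=
  [set r | r < 0 /\ ~ bihomogeneous (radical (sigma (- r) 1 I))].

End Slopes.

(* Main.v *)
Require Import Defs.
From HB Require Import structures.
From mathcomp Require Import all_boot all_order all_algebra.
From mathcomp Require Import boolp classical_sets reals.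
From mathcomp Require Import complex mpoly zify ring.

Set Implicit Arguments.
Unset Strict Implicit.
Unset Printing Implicit Defensive.

Import Order.TTheory GRing.Theory Num.Theory.
Local Open Scope ring_scope.

(** * The slopes of a GKZ system of a monomial curve

    Write [a_1 < ... < a_N] for the entries of [A] and [s = - r] for the opposite
    of the candidate slope, so that [d_i] has weight [s] for [i < N] and
    [d_N] has weight [s + 1].  The set of slopes along [x_N = 0] turns out to be the
    singleton of [- a_(N-1) / (a_N - a_(N-1))].  It depends on the last two
    entries only, and the theorem follows by applying this to both systems.

    The radical of the ideal generated by the initial forms is bounded below by
    explicit operators: the binomials [d_i ^ a_j - d_j ^ a_i] and the Euler operator.
    It is bounded above by looking at the action on the integrand
    [exp h * t ^ (- beta - 1)] of the hypergeometric integral, with phase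
    [h = \sum_i x_i t ^ a_i].  If [P] is in the GKZ ideal, then substituting
    [xi_i := t ^ a_i] in its normally ordered symbol gives an element in the image
    of the operator [t h' + t d/dt - beta] on polynomials in [x] and [t]
    (exp_subst_GKZ).  Give [t] the largest weight [om] for which no [t ^ a_i] weighs
    more than [d_i], and call [i] leading if the two weights agree.  Comparing the
    parts of top weight, where only multiplication by the leading part of [t h']
    survives, shows that the initial form of [P], restricted to [xi_i = t ^ a_i]
    for leading [i] and [xi_i = 0] otherwise, is a multiple of
    [\sum_(i leading) a_i x_i t ^ a_i] (leading_initial_form).

    The index [N - 1] or [N] is always leading, and no other index ever is.

    If one index [e] is leading, both bounds agree: the radical is the ideal of
    the union of the zero section and of the conormal space of [x_e = 0]
    (rad_one_leading).  Membership in it is a condition on single coefficients, so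
    it is homogeneous for every grading and there is no slope.

    If both [N - 1] and [N] are leading, which happens for exactly one [s], then
    [xi_(N-1) ^ a_N - xi_N ^ a_(N-1)] is in the radical.  Its homogeneous part
    [xi_(N-1) ^ a_N] is not, because all elements of the radical vanish at [x = 0],
    [xi_(N-1) = xi_N = 1], [xi_i = 0] otherwise, by the upper bound at [x = 0], [t = 1]
    (not_bihomogeneous_two_leading). *)

(** * Ideals and selections of terms *)

Section Ideals.
Variable S : comNzRingType.
Implicit Types (G I J : set S) (a b : S).

Lemma sub_ideal_gen G a : G a -> ideal_gen G a.
Proof. by move=> Ga J [_ ]; exact. Qed.

Lemma ideal_gen_ideal G : left_ideal (ideal_gen G).
Proof.
split=> [J [[]]//|a b Ia Ib J [idJ GJ]|a b Ib J [idJ GJ]]; case: (idJ) => _ JD JM.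
  by apply: JD; [apply: Ia|apply: Ib].
by apply: JM; apply: Ib.
Qed.

Lemma ideal_gen_sub (S' : nzRingType) (G I : set S') :
  left_ideal I -> (G `<=` I)%classic -> (ideal_gen G `<=` I)%classic.
Proof. by move=> idI GI a; apply. Qed.

Lemma ideal_sum I (T : Type) (s : seq T) (b : pred T) (f : T -> S) :
  left_ideal I -> (forall i, b i -> I (f i)) -> I (\sum_(i <- s | b i) f i).
Proof. by move=> [I0 ID _] If; elim/big_ind: _. Qed.

Lemma ideal_sum_seq I (T : eqType) (s : seq T) (f : T -> S) :
  left_ideal I -> (forall i, i \in s -> I (f i)) -> I (\sum_(i <- s) f i).
Proof. by move=> idI If; rewrite big_seq; apply: ideal_sum. Qed.

Lemma idealN I a : left_ideal I -> I a -> I (- a).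
Proof. by move=> [_ _ IM] Ia; rewrite -mulN1r; apply: IM. Qed.

Lemma ideal_addKr I a b : left_ideal I -> I b -> I (a + b) -> I a.
Proof.
by move=> idI Ib Iab; have [_ ID _] := idI; rewrite -(addrK b a); apply: ID => //; exact: idealN.
Qed.

Lemma sub_radical I : (I `<=` radical I)%classic.
Proof. by move=> a Ia; exists 1%N. Qed.

Lemma radicalX I a k : radical I (a ^+ k) -> radical I a.
Proof. by move=> [l]; rewrite -exprM; exists (k * l)%N. Qed.

(** In the binomial expansion of [(a + b) ^+ (k + l)] every term contains
    [a ^+ k] or [b ^+ l]. *)
Lemma radical_ideal I : left_ideal I -> left_ideal (radical I).
Proof.
move=> idI; have [I0 ID IM] := idI; split=> [|a b [k Ik] [l Il]|a b [k Ik]].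
- by exists 1%N; rewrite expr1.
- exists (k + l)%N; rewrite exprDn; apply: ideal_sum => // i _.
  rewrite -mulr_natl; apply: (IM); have [le_li|lt_il] := leqP l i.
    by rewrite -(subnK le_li) exprD mulrA; apply: IM.
  have -> : (k + l - i = (l - i) + k)%N by rewrite -addnBA 1?addnC // ltnW.
  by rewrite exprD mulrC mulrA; apply: IM.
- by exists k; rewrite exprMn; apply: IM.
Qed.

(** The complement of a prime ideal contains [1] and is closed under products, hence
    contains the powers of its elements. *)
Lemma radical_prime I f : ~ I 1 -> (forall a b, I (a * b) -> I a \/ I b) ->
  radical I f -> I f.
Proof.
by move=> I1 Iprime [k]; elim: k => // k IH; rewrite exprS => /Iprime[].
Qed.

End Ideals.

Section Select.
Variables (k : nat) (S : nzRingType).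
Implicit Types (b : pred 'X_{1..k}) (p q : {mpoly S[k]}) (m u : 'X_{1..k}).

(** The common shape of homogeneous parts, of weighted parts and of initial forms,
    which are all convertible to an instance of [mselect]. *)
Definition mselect b p : {mpoly S[k]} := \sum_(m <- msupp p | b m) p@_m *: 'X_[m].

Lemma mcoeff_mselect b p m : (mselect b p)@_m = if b m then p@_m else 0.
Proof.
rewrite /mselect raddf_sum /=.
under eq_bigr => i _ do rewrite mcoeffZ mcoeffX.
have [mp|mp] := boolP (m \in msupp p); last first.
  rewrite (memN_msupp_eq0 mp) if_same big_seq_cond big1 // => i /andP[ip _].
  by case: eqP mp => [<-|_ _]; rewrite ?ip // mulr0.
rewrite big_mkcond (bigD1_seq m) ?msupp_uniq //= eqxx mulr1 big1 ?addr0 // => i im.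
by rewrite (negbTE im) mulr0 if_same.
Qed.

Lemma mselect_is_additive b : zmod_morphism (mselect b).
Proof.
move=> p q; apply/mpolyP => m; rewrite mcoeffB !mcoeff_mselect mcoeffB.
by case: ifP; rewrite ?subr0.
Qed.
HB.instance Definition _ b :=
  GRing.isZmodMorphism.Build {mpoly S[k]} {mpoly S[k]} (mselect b) (mselect_is_additive b).

Lemma mselect0 b : mselect b 0 = 0. Proof. exact: raddf0. Qed.

Lemma mselectD b p q : mselect b (p + q) = mselect b p + mselect b q.
Proof. exact: raddfD. Qed.

Lemma mselectB b p q : mselect b (p - q) = mselect b p - mselect b q.
Proof. exact: raddfB. Qed.

Lemma mselectMn b p i : mselect b (p *+ i) = mselect b p *+ i.
Proof. exact: raddfMn. Qed.

Lemma mselect_sum b (I : Type) (s : seq I) (F : I -> {mpoly S[k]}) :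
  mselect b (\sum_(i <- s) F i) = \sum_(i <- s) mselect b (F i).
Proof. exact: raddf_sum. Qed.

Lemma mselectZ b c p : mselect b (c *: p) = c *: mselect b p.
Proof.
by apply/mpolyP => m; rewrite mcoeffZ !mcoeff_mselect mcoeffZ; case: ifP; rewrite ?mulr0.
Qed.

Lemma mselectX b m : mselect b 'X_[m] = if b m then 'X_[m] else 0.
Proof.
apply/mpolyP => m'; rewrite mcoeff_mselect mcoeffX.
have [<-|ne] := eqVneq m m'; first by case: (b m); rewrite ?mcoeffX ?mcoeff0 ?eqxx.
by rewrite if_same; case: (b m); rewrite ?mcoeffX ?mcoeff0 ?(negbTE ne).
Qed.

Lemma mselect_id b p : {in msupp p, forall m, b m} -> mselect b p = p.
Proof.
move=> bp; apply/mpolyP => m; rewrite mcoeff_mselect.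
by have [/bp->//|/memN_msupp_eq0->] := boolP (m \in msupp p); rewrite if_same.
Qed.

Lemma mselect_eq0 b p : {in msupp p, forall m, ~~ b m} -> mselect b p = 0.
Proof.
move=> bp; apply/mpolyP => m; rewrite mcoeff_mselect mcoeff0.
by have [/bp/negbTE->//|/memN_msupp_eq0->] := boolP (m \in msupp p); rewrite if_same.
Qed.

Lemma eq_mselect b b' p : {in msupp p, b =1 b'} -> mselect b p = mselect b' p.
Proof.
move=> bb; apply/mpolyP => m; rewrite !mcoeff_mselect.
by have [/bb->//|/memN_msupp_eq0->] := boolP (m \in msupp p); rewrite !if_same.
Qed.

Lemma mselectMX b u p :
  mselect b ('X_[u] * p) = 'X_[u] * mselect (fun m => b (u + m)%MM) p.
Proof.
have XZ c m : 'X_[u] * (c *: 'X_[m]) = c *: 'X_[u + m] :> {mpoly S[k]}.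
  by rewrite -commr_mpolyX -scalerAl -mpolyXD addmC.
elim/mpolyind: p => [|c m p _ _ IH]; first by rewrite mulr0 !raddf0 mulr0.
rewrite mulrDr !raddfD /= IH mulrDr XZ !mselectZ !mselectX; congr (_ + _).
by case: ifP; rewrite ?XZ ?scaler0 ?mulr0.
Qed.

End Select.

(** * Ideals of series given by conditions on coefficients *)

Section CoefficientIdeals.
Variables (k : nat) (Z : pred 'I_k).
Implicit Types m : 'X_{1..k}.

Definition avoids m := [forall i, Z i ==> (m i == 0%N)].

Lemma avoidsD m1 m2 : avoids (m1 + m2)%MM = avoids m1 && avoids m2.
Proof.
apply/forallP/andP => [av|[/forallP av1 /forallP av2] i]; last first.
  have := av1 i; have := av2 i; rewrite mnmDE addn_eq0.
  by case: (Z i) => //= -> ->.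
split; apply/forallP => i; have := av i; rewrite mnmDE addn_eq0;
  by case: (Z i) => //= /andP[].
Qed.

Lemma avoids0 : avoids 0%MM.
Proof. by apply/forallP => i; rewrite mnm0E eqxx implybT. Qed.

Lemma avoidsN m i : Z i -> (0 < m i)%N -> avoids m = false.
Proof. by move=> Zi mi; apply/negP => /forallP/(_ i); rewrite Zi eqn0Ngt mi. Qed.

Lemma avoidsPn m : ~~ avoids m -> exists2 i, Z i & (0 < m i)%N.
Proof.
by move=> /forallPn[j]; rewrite negb_imply -lt0n => /andP[]; exists j.
Qed.

Variables (S : comNzRingType) (Q : set S).
Implicit Types f g : 'X_{1..k} -> S.

(** The Cauchy product, which is the product of power series as well as of
    polynomials; the results below are used for both. *)
Definition cauchy f g m : S :=
  \sum_(u : 'X_{1..k < (mdeg m).+1, (mdeg m).+1} | m == (u.1 + u.2)%MM) f u.1 * g u.2.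

(** If [Q] is an ideal, [coef_in] is the inverse image of the ideal of series with
    coefficients in [Q] under the map setting the variables in [Z] to zero. *)
Definition coef_in f := forall m, avoids m -> Q (f m).

Hypothesis idQ : left_ideal Q.

Lemma coef_in_cauchy f g : coef_in g -> coef_in (cauchy f g).
Proof.
move=> Qg m avm; apply: ideal_sum => // -[u v] /= /eqP mE.
have [_ _ QM] := idQ; apply: QM; apply: Qg.
by have := congr1 avoids mE; rewrite avm avoidsD => /esym/andP[].
Qed.

Lemma minimal_not_coef_in f : ~ coef_in f -> exists m,
  [/\ avoids m, ~ Q (f m) & forall m', (m' < m)%O -> avoids m' -> Q (f m')].
Proof.
move=> nQf; apply: contrapT => nomin; apply: nQf => m.
elim/(well_founded_induction (@ltom_wf k)): m => m IH avm.
by apply: contrapT => nQm; apply: nomin; exists m.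
Qed.

(** If [Q] is prime then so is [coef_in]: at the sum of the minimal monomials
    whose coefficients are not in [Q], the product has exactly one term outside
    [Q].  Minimal monomials are used because power series need not have a
    largest one. *)
Lemma coef_in_prime f g : (forall a b, Q (a * b) -> Q a \/ Q b) ->
  coef_in (cauchy f g) -> coef_in f \/ coef_in g.
Proof.
move=> Qprime Qfg; have [_ _ QM] := idQ.
apply: contrapT => /not_orP[/minimal_not_coef_in[m1 [av1 nQ1 min1]]].
move=> /minimal_not_coef_in[m2 [av2 nQ2 min2]].
have lt1 : (mdeg m1 < (mdeg (m1 + m2)).+1)%N by rewrite mdegD ltnS leq_addr.
have lt2 : (mdeg m2 < (mdeg (m1 + m2)).+1)%N by rewrite mdegD ltnS leq_addl.
have av12 : avoids (m1 + m2)%MM by rewrite avoidsD av1.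
have := Qfg _ av12; rewrite /cauchy (bigD1 (BMultinom lt1, BMultinom lt2)) //=.
set rest := (X in _ + X) => Qs; have Qrest : Q rest.
  apply: ideal_sum => // -[[u ltu] [v ltv]] /= /andP[/eqP uv ne].
  have /andP[avu avv] : avoids u && avoids v by rewrite -avoidsD -uv.
  have [lt_u1|gt_u1|eq_u1] := ltgtP u m1.
  - by rewrite mulrC; apply/QM/min1.
  - apply/QM/min2 => //; rewrite ltNge; apply/negP => le2v.
    by have := ltmc_le_add gt_u1 le2v; rewrite -uv ltxx.
  - move: ne; rewrite xpair_eqE -!val_eqE /= eq_u1 eqxx.
    by move: uv; rewrite eq_u1 => /addmI->; rewrite eqxx.
by case/Qprime: (ideal_addKr idQ Qrest Qs).
Qed.

End CoefficientIdeals.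

Section Series.
Variables (n : nat) (K : numFieldType).
Implicit Types (f g : cseries n K) (a : 'X_{1..n}) (i : 'I_n).

Lemma cseries0E a : (0 : cseries n K) a = 0.
Proof. exact: mcoeff0. Qed.

Lemma cseries1E a : (1 : cseries n K) a = (a == 0%MM)%:R.
Proof. exact: mcoeff1. Qed.

Definition cst_coef f : K := f 0%MM.

Fact cst_coef_is_zmod : zmod_morphism cst_coef.
Proof. by []. Qed.
HB.instance Definition _ :=
  GRing.isZmodMorphism.Build (cseries n K) K cst_coef cst_coef_is_zmod.

Fact cst_coef_is_monoid : monoid_morphism cst_coef.
Proof.
split=> [|f g]; first by rewrite /cst_coef cseries1E eqxx.
rewrite /cst_coef -[LHS]/(conv_mul f g 0%MM) (@conv_mul_trunc _ _ _ _ 1) ?mdeg0 //.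
by rewrite rmorphM /= !mcoeff_trunc ?mdeg0.
Qed.
HB.instance Definition _ :=
  GRing.isMonoidMorphism.Build (cseries n K) K cst_coef cst_coef_is_monoid.

Lemma cpolyX_mulE i f a :
  (cpoly 'X_i * f) a = if (0 < a i)%N then f (a - U_(i))%MM else 0.
Proof.
have -> : (cpoly 'X_i * f) a = ('X_i * trunc f (mdeg a).+1)@_a.
  by apply: conv_mulE => // b ba; rewrite mcoeff_trunc.
case: ltnP => ai; last first.
  rewrite mcoeffM big1 // => -[u v] /= /eqP aE; rewrite mcoeffX.
  case: eqP => [ui|]; last by rewrite mul0r.
  by have := congr1 (fun b : 'X_{1..n} => b i) aE; rewrite mnmDE -ui mnm1E eqxx; lia.
have Ua : (U_(i) <= a)%MM by rewrite lep1mP -lt0n.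
rewrite -{1}(submK Ua) addmC -commr_mpolyX mcoeffMX mcoeff_trunc //.
by rewrite ltnS -{2}(submK Ua) mdegD leq_addr.
Qed.

(** The shifted series converges where the given one does, because the shift
    costs a factor of the radius. *)
Lemma convergent_shift i f : convergent (fun a => f (a + U_(i))%MM).
Proof.
have [r r0 [M fM]] := cseriesP f; exists r => //; exists (r^-1 * M) => d.
apply: le_trans (_ : r^-1 * abs_sum f r d.+1 <= _); last first.
  by rewrite ler_wpM2l ?invr_ge0 // ltW.
rewrite /abs_sum mulr_sumr.
have lt_s (a : 'X_{1..n < d}) : (mdeg (a + U_(i)) < d.+1)%N.
  by rewrite mdegD mdeg1 addn1 ltnS bmdeg.
pose s (a : 'X_{1..n < d}) : 'X_{1..n < d.+1} := BMultinom (lt_s a).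
have s_inj : injective s.
  by move=> a b /(congr1 (@bmnm _ _)) /= /addIm ab; apply/val_inj.
rewrite [leRHS](bigID (fun b => b \in [set s a | a : 'X_{1..n < d}]%SET)) /=.
rewrite big_imset /=; last by move=> a b _ _; exact: s_inj.
rewrite -[leLHS]addr0 lerD //; last first.
  by apply: sumr_ge0 => b _; rewrite !mulr_ge0 ?invr_ge0 ?exprn_ge0 // ltW.
rewrite le_eqVlt; apply/orP; left; apply/eqP; apply: eq_big => // a _.
by rewrite mdegD mdeg1 addn1 exprS mulrCA mulKf // gt_eqF.
Qed.

Lemma cseries_divX i f : (forall a, a i = 0%N -> f a = 0) ->
  exists g, f = cpoly 'X_i * g.
Proof.
move=> f0; exists (mkcseries (convergent_shift i f)); apply: cseries_ext => a.
rewrite cpolyX_mulE /=; case: ltnP => ai; last by apply: f0; lia.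
by rewrite submK // lep1mP -lt0n.
Qed.

End Series.

(** * The integrand of the hypergeometric integral *)

Section Exponential.
Variables (K : comNzRingType) (n : nat) (A : n.-tuple nat).
Local Notation T := {mpoly K[n + 1]}.
Local Notation x i := ('X_(lshift 1 i) : T).
Local Notation tvar := (rshift n (ord0 : 'I_1)).
Local Notation t := ('X_tvar : T).
Local Notation a := (tnth A).
Implicit Types (p : {mpoly K[n + n]}) (f : T) (m : 'X_{1..n + n}).

Definition exp_mnm m : 'X_{1..n + 1} :=
  [multinom match split i with
            | inl j => m (lshift n j)
            | inr _ => (\sum_j a j * m (rshift n j))%N
            end | i < n + 1].

Definition exp_var (i : 'I_(n + n)) : T :=
  match split i with inl j => x j | inr j => t ^+ a j end.

(** The substitution [xi_i := t ^+ a_i].  Its value at [symb P] is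
    [exp (- h) * P (exp h)] for the phase [h = \sum_i x_i t ^ a_i]. *)
Definition exp_subst : {mpoly K[n + n]} -> T := mmap (@mpolyC (n + 1) K) exp_var.
HB.instance Definition _ := GRing.RMorphism.copy exp_subst (mmap (@mpolyC (n + 1) K) exp_var).

Lemma exp_mnml m j : exp_mnm m (lshift 1 j) = m (lshift n j).
Proof. by rewrite mnmE (unsplitK (inl j)). Qed.

Lemma exp_mnmr m : exp_mnm m tvar = (\sum_j a j * m (rshift n j))%N.
Proof. by rewrite mnmE (unsplitK (inr ord0)). Qed.

Lemma exp_substX m : exp_subst 'X_[m] = 'X_[exp_mnm m].
Proof.
rewrite /exp_subst mmapX /mmap1 [RHS]mpolyXE_id !big_split_ord /=; congr (_ * _).
  by apply: eq_bigr => i _; rewrite /exp_var (unsplitK (inl i)) exp_mnml.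
rewrite big_ord1 exp_mnmr expr_sum; apply: eq_bigr => i _.
by rewrite /exp_var (unsplitK (inr i)) exprM.
Qed.

Lemma exp_substXl i : exp_subst 'X_(lshift n i) = x i.
Proof. by rewrite /exp_subst mmapX mmap1U /exp_var (unsplitK (inl i)). Qed.

Lemma exp_substXr i : exp_subst 'X_(rshift n i) = t ^+ a i.
Proof. by rewrite /exp_subst mmapX mmap1U /exp_var (unsplitK (inr i)). Qed.

Lemma exp_subst0 : exp_subst 0 = 0. Proof. exact: rmorph0. Qed.

Lemma exp_substD p q : exp_subst (p + q) = exp_subst p + exp_subst q.
Proof. exact: rmorphD. Qed.

Lemma exp_substZ c p : exp_subst (c *: p) = c *: exp_subst p.
Proof. by rewrite /exp_subst mmapZ mul_mpolyC. Qed.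

Lemma mderiv_exp_subst i p :
  (exp_subst p)^`M(lshift 1 i) = exp_subst (p^`M(lshift n i)).
Proof.
elim/mpolyind: p => [|c m p _ _ IH]; first by rewrite !raddf0.
rewrite !(raddfD, rmorphD) /= IH; congr (_ + _).
rewrite mderivZ !exp_substZ mderivZ exp_substX !mderivX exp_substZ exp_substX exp_mnml.
congr (_ *: (_ *: 'X_[_])); apply/mnmP => j; rewrite mnmBE.
case: (split_ordP j) => k ->.
  by rewrite !exp_mnml mnmBE !mnm1E !eq_lshift.
rewrite [k]ord1 !exp_mnmr mnm1E eq_lrshift subn0; apply: eq_bigr => l _.
by rewrite mnmBE mnm1E eq_lrshift subn0.
Qed.

(** The derivative [t * dh/dt] of the phase. *)
Definition dphase : T := \sum_i (a i)%:R * (x i * t ^+ a i).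

Variable beta : K.

(** Right multiplication by the Euler operator, transported to [K[x, t]], which
    contains the quotient of the Weyl algebra by the left ideal generated by the
    toric operators. *)
Definition euler_op f : T := dphase * f + t * f^`M(tvar) - beta%:MP * f.

(** The operator [d_i], conjugated by the exponential of the phase. *)
Definition exp_d i f : T := t ^+ a i * f + f^`M(lshift 1 i).

Lemma exp_subst_dmul i p : exp_subst (dmul i p) = exp_d i (exp_subst p).
Proof. by rewrite /dmul rmorphD rmorphM /= exp_substXr -mderiv_exp_subst. Qed.

Lemma t_mderiv_tX k : t * (t ^+ k)^`M(tvar) = k%:R * t ^+ k.
Proof.
elim: k => [|k IH]; first by rewrite expr0 mul0r -mpolyC1 mderivC mulr0.
rewrite exprS mderivM mulrDr mulrCA IH mderivX mnm1E eqxx scale1r.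
rewrite -[X in (X - _)%MM]add0m addmK mpolyX0 -natr1 mul1r; ring.
Qed.

Lemma mderiv_x_tX i k : (t ^+ k)^`M(lshift 1 i) = 0.
Proof.
elim: k => [|k IH]; first by rewrite expr0 -mpolyC1 mderivC.
by rewrite exprS mderivM IH mderivX mnm1E eq_rlshift scale0r mul0r mulr0 addr0.
Qed.

Lemma mderiv_x_x i j : (x j)^`M(lshift 1 i) = (j == i)%:R.
Proof.
rewrite mderivX mnm1E eq_lshift; case: eqP => [->|_]; last by rewrite scale0r.
by rewrite scale1r -[X in (X - _)%MM]add0m addmK mpolyX0.
Qed.

Lemma mderiv_nat k (i : 'I_(n + 1)) : (k%:R : T)^`M(i) = 0.
Proof. by rewrite -mpolyC_nat mderivC. Qed.

Lemma mderiv_dphase i : dphase^`M(lshift 1 i) = (a i)%:R * t ^+ a i.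
Proof.
rewrite /dphase raddf_sum (bigD1 i) //= big1 ?addr0 => [|j ji].
  rewrite !mderivM mderiv_nat mderiv_x_x mderiv_x_tX eqxx /=; ring.
by rewrite !mderivM mderiv_nat mderiv_x_x mderiv_x_tX (negbTE ji) /=; ring.
Qed.

(** The two contributions to the commutator cancel: both [d/dx_i] applied to
    [t * dh/dt] and [t * d/dt] applied to [t ^+ a_i] give [a_i * t ^+ a_i]. *)
Lemma exp_d_euler_op i f : exp_d i (euler_op f) = euler_op (exp_d i f).
Proof.
rewrite /exp_d /euler_op !mderivB !mderivD !mderivM mderivC mderiv_dphase.
rewrite [t^`M(_)](mderiv_x_tX i 1) (mderiv_comm (lshift 1 i) tvar).
by have tu := t_mderiv_tX (a i); ring: tu.
Qed.

Lemma x_euler_op i f : x i * euler_op f = euler_op (x i * f).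
Proof.
rewrite /euler_op mderivM mderivX mnm1E eq_lrshift scale0r mul0r; ring.
Qed.

Lemma euler_opD f g : euler_op (f + g) = euler_op f + euler_op g.
Proof. rewrite /euler_op mderivD; ring. Qed.

Lemma euler_opZ c f : euler_op (c *: f) = c *: euler_op f.
Proof. rewrite /euler_op mderivZ -!mul_mpolyC; ring. Qed.

Lemma exp_subst_left_ideal :
  left_ideal [set P : weyl n K | exists f, exp_subst (symb P) = euler_op f]%classic.
Proof.
split=> [|P Q [f Pf] [g Qg]|Q P [f Pf]] /=.
- by exists 0; rewrite rmorph0 /euler_op raddf0 !mulr0 addr0 subr0.
- by exists (f + g); rewrite rmorphD /= Pf Qg euler_opD.
- rewrite /nmul; elim/big_rec: _ => [|m q _ [g qg]].
    by exists 0; rewrite rmorph0 /euler_op raddf0 !mulr0 addr0 subr0.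
  suff [g' mg'] : exists g', exp_subst (xmon K m * dmulm m (symb P)) = euler_op g'.
    exists ((symb Q)@_m *: g' + g).
    by rewrite rmorphD /= exp_substZ mg' qg euler_opD euler_opZ.
  have [f' f'E] : exists f', exp_subst (dmulm m (symb P)) = euler_op f'.
    rewrite /dmulm; elim: (enum _) => [|i s [f1 IH]] /=; first by exists f.
    elim: (m _) => [|k [f2 IHk]] /=; first by exists f1.
    by exists (exp_d i f2); rewrite exp_subst_dmul IHk exp_d_euler_op.
  rewrite /xmon; elim: (index_enum _) => [|i s [f1 IH]].
    by exists f'; rewrite big_nil mul1r.
  rewrite big_cons -mulrA; elim: (m _) => [|k [f2 IHk]].
    by exists f1; rewrite mul1r.
  exists (x i * f2).
  by rewrite exprS -mulrA rmorphM /= IHk exp_substXl x_euler_op.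
Qed.

Lemma symb_diffop (p : {mpoly K[n]}) :
  symb (diffop p) = mmap (@mpolyC (n + n) K) (fun i => 'X_(rshift n i)) p.
Proof.
rewrite /diffop /mmap (big_morph (@symb n K) (fun P Q => erefl) (erefl : symb 0 = 0)).
apply: eq_bigr => m _; rewrite [RHS]mul_mpolyC /= -[_%:MP]mulr1 mul_mpolyC nmulZl nmul1l.
rewrite /mmap1; congr (_ *: _).
pose h := \prod_(i < n) ('X_(rshift n i) : {mpoly K[n + n]}) ^+ m i.
suff [-> _] : symb (\prod_(i < n) wd K i ^+ m i) = h /\
    forall j, h^`M(lshift n j) = 0 by [].
rewrite {}/h; elim: (index_enum _) => [|i s [IH1 IH2]].
  by rewrite !big_nil; split=> // j; rewrite -mpolyC1 mderivC.
rewrite !big_cons; elim: (m i) => [|k [IH3 IH4]]; first by rewrite !mul1r.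
rewrite !exprS -!mulrA symb_wd_mul IH3 /dmul IH4 addr0; split=> // j.
by rewrite mderivM IH4 mulr0 mderivX mnm1E eq_rlshift scale0r mul0r addr0.
Qed.

Lemma exp_subst_diffop (p : {mpoly K[n]}) :
  exp_subst (symb (diffop p)) = mmap (@mpolyC (n + 1) K) (fun i => t ^+ a i) p.
Proof.
rewrite symb_diffop /mmap rmorph_sum /=; apply: eq_bigr => m _.
rewrite rmorphM /= {1}/exp_subst mmapC /mmap1 rmorph_prod /=; congr (_ * _).
by apply: eq_bigr => i _; rewrite rmorphXn /= exp_substXr.
Qed.

Lemma exp_subst_toric (p : {mpoly K[n]}) : toric_ideal A p -> exp_subst (symb (diffop p)) = 0.
Proof.
rewrite exp_subst_diffop.
pose I := [set q | mmap (@mpolyC (n + 1) K) (fun i => t ^+ a i) q = 0]%classic.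
suff idI : left_ideal I.
  apply: (ideal_gen_sub idI) => _ [u [v [uv ->]]]; rewrite /I /= rmorphB /= !mmapX.
  have E w : mmap1 (fun i => t ^+ a i) w = t ^+ Adeg A w.
    by rewrite /Adeg expr_sum; apply: eq_bigr => i _; rewrite exprM.
  by rewrite !E uv subrr.
split=> [|q r|q r]; rewrite /I /= ?rmorph0 ?rmorphD ?rmorphM //=.
  by move=> -> ->; rewrite addr0.
by move=> ->; rewrite mulr0.
Qed.

Lemma symb_euler : symb (euler A beta) =
  \sum_i (a i)%:R * ('X_(lshift n i) * 'X_(rshift n i)) - beta%:MP.
Proof.
rewrite /euler -[LHS]/(symb _ - symb _); congr (_ - _).
rewrite (big_morph (@symb n K) (fun P Q => erefl) (erefl : symb 0 = 0)).
apply: eq_bigr => i _; rewrite -mulrA !mulr_natl.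
rewrite -[wx K i * _]/(Weyl (nmul _ _)).
elim: (a i) => [|k IH]; first by rewrite !mulr0n.
rewrite !mulrS -IH; congr (_ + _) => /=.
by rewrite -[LHS]/(symb (wx K i * wd K i)) symb_wx_mul.
Qed.

(** Elements of the GKZ ideal annihilate the integral of
    [exp h * t ^ (- beta - 1)], because they turn the integrand into a total
    derivative; this is the algebraic form of that statement. *)
Lemma exp_subst_GKZ P : GKZ_ideal A beta P ->
  exists f, exp_subst (symb P) = euler_op f.
Proof.
apply: (ideal_gen_sub exp_subst_left_ideal) => _ [[p Ip <-]|->].
  by exists 0; rewrite exp_subst_toric // /euler_op raddf0 !mulr0 addr0 subr0.
exists 1; rewrite symb_euler rmorphB /= {2}/exp_subst mmapC /euler_op.
rewrite -mpolyC1 mderivC mulr0 addr0 !mulr1; congr (_ - _).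
rewrite rmorph_sum; apply: eq_bigr => i _.
by rewrite !rmorphM rmorph_nat /= exp_substXl exp_substXr.
Qed.

End Exponential.

(** * Weights and the graded parametrization *)

Section Weights.
Variable R : realType.

Definition wt k (w : 'I_k -> R) (m : 'X_{1..k}) : R := \sum_i w i * (m i)%:R.

Lemma wtD k (w : 'I_k -> R) m1 m2 : wt w (m1 + m2)%MM = wt w m1 + wt w m2.
Proof. by rewrite -big_split; apply: eq_bigr => i _; rewrite mnmDE natrD mulrDr. Qed.

Lemma wt_mul1 k (w : 'I_k -> R) i e : wt w (U_(i) *+ e)%MM = w i * e%:R.
Proof.
rewrite /wt (bigD1 i) //= mulmnE mnm1E eqxx mul1n big1 ?addr0 // => j ji.
by rewrite mulmnE mnm1E eq_sym (negbTE ji) mulr0.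
Qed.

Lemma exists_max_seq (T : eqType) (s : seq T) (F : T -> R) : s != [::] ->
  exists2 x, x \in s & {in s, forall y, F y <= F x}.
Proof.
elim: s => // x [_ _|y s /(_ isT)[z zs zmax] _].
  by exists x; rewrite ?mem_head // => y; rewrite inE => /eqP->.
have [le_xz|lt_zx] := leP (F x) (F z).
  exists z; first by rewrite inE zs orbT.
  by move=> u; rewrite inE => /predU1P[->|/zmax].
exists x; first exact: mem_head.
move=> u; rewrite inE => /predU1P[->//|/zmax le_uz].
by rewrite (le_trans le_uz) // ltW.
Qed.

Variables (n : nat) (s : R).

Definition Lw (i : 'I_(n.+1 + n.+1)) : R :=
  s * (weightF i)%:~R + (weightV i)%:~R.

Lemma Lweight_wt m : Lweight s 1 m = wt Lw m.
Proof.
rewrite /Lweight /wdeg mul1r !raddf_sum mulr_sumr -big_split.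
by apply: eq_bigr => i _; rewrite /= !intrM mulrDl mulrA.
Qed.

Lemma Lw_l i : Lw (lshift n.+1 i) = - (i == ord_max)%:R.
Proof.
rewrite /Lw /weightF /weightV (unsplitK (inl i)) mulr0 add0r.
by case: eqP => _ /=; rewrite ?mulrN1z ?oppr0.
Qed.

Lemma Lw_r i : Lw (rshift n.+1 i) = s + (i == ord_max)%:R.
Proof.
rewrite /Lw /weightF /weightV (unsplitK (inr i)) mulr1.
by case: eqP.
Qed.

Lemma Lw_lr i : Lw (lshift n.+1 i) + Lw (rshift n.+1 i) = s.
Proof. by rewrite Lw_l Lw_r addrCA addNr addr0. Qed.

Lemma initial_formE (P : weyl n.+1 R[i]) p q W : symb P = p + q -> p != 0 ->
  {in msupp p, forall m, wt Lw m = W} -> {in msupp q, forall m, wt Lw m < W} ->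
  initial_form s 1 P = p.
Proof.
move=> PE p0 pW qW; pose b := fun m => wt Lw m == W.
have pb : mselect b p = p by apply: mselect_id => m /pW mW; apply/eqP.
have qb : mselect b q = 0 by apply: mselect_eq0 => m /qW mW; rewrite /b lt_eqF.
suff -> : initial_form s 1 P = mselect b (symb P) by rewrite PE raddfD /= pb qb addr0.
have suppW m : m \in msupp (symb P) -> wt Lw m <= W.
  by rewrite PE => /msuppD_le; rewrite mem_cat => /orP[/pW->//|/qW/ltW].
have [m0 m0p] : exists m, m \in msupp p.
  by case: (msupp p) (msupp_eq0 p) (p0) => [<-|m ? _ _] //; exists m; exact: mem_head.
have m0P : m0 \in msupp (symb P).
  rewrite mcoeff_msupp PE mcoeffD (memN_msupp_eq0 (p := q)) ?addr0 -?mcoeff_msupp //.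
  by apply/negP => /qW; rewrite (pW _ m0p) ltxx.
apply: eq_mselect => m mP; rewrite /b; apply/allP/eqP => [mmax|mW m' m'P]; last first.
  by rewrite !Lweight_wt mW suppW.
by apply/le_anti; rewrite suppW //= -(pW _ m0p) -!Lweight_wt mmax.
Qed.

End Weights.

Section GradedParametrization.
Variables (R : realType) (K : numFieldType) (n : nat) (A : n.+1.-tuple nat) (s om : R).
Local Notation N := n.+1.
Local Notation T := {mpoly K[N + 1]}.
Local Notation x i := ('X_(lshift 1 i) : T).
Local Notation tvar := (rshift N (ord0 : 'I_1)).
Local Notation t := ('X_tvar : T).
Local Notation a := (tnth A).
Local Notation Lw := (@Lw R n s).

Hypothesis s0 : 0 < s.
(** With weight [om] for [t], the substitution [xi_i := t ^+ a_i] does not raise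
    weights.  The leading indices are those for which it preserves them. *)
Hypothesis om_le : forall i, om * (a i)%:R <= Lw (rshift N i).

Definition leading i := om * (a i)%:R == Lw (rshift N i).

Definition ew (i : 'I_(N + 1)) : R :=
  match split i with inl j => Lw (lshift N j) | inr _ => om end.

Definition leading_mnm (m : 'X_{1..N + N}) :=
  [forall i, leading i || (m (rshift N i) == 0%N)].

Definition leading_dphase : T := \sum_(i | leading i) (a i)%:R * (x i * t ^+ a i).

Lemma wt_exp_mnm m : wt Lw m =
  wt ew (exp_mnm A m) + \sum_i (Lw (rshift N i) - om * (a i)%:R) * (m (rshift N i))%:R.
Proof.
rewrite /wt !big_split_ord big_ord1 /= -addrA; congr (_ + _).
  by apply: eq_bigr => i _; rewrite /ew (unsplitK (inl i)) exp_mnml.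
rewrite /ew (unsplitK (inr ord0)) exp_mnmr natr_sum mulr_sumr -big_split.
by apply: eq_bigr => i _; rewrite natrM /= mulrBl mulrA addrC subrK.
Qed.

Lemma wt_exp_mnm_ge0 m i :
  0 <= (Lw (rshift N i) - om * (a i)%:R) * (m (rshift N i))%:R.
Proof. by rewrite mulr_ge0 // subr_ge0. Qed.

Lemma wt_exp_mnm_le m : wt ew (exp_mnm A m) <= wt Lw m.
Proof. by rewrite wt_exp_mnm lerDl sumr_ge0 // => i _; exact: wt_exp_mnm_ge0. Qed.

Lemma wt_exp_mnm_eq m : (wt ew (exp_mnm A m) == wt Lw m) = leading_mnm m.
Proof.
rewrite wt_exp_mnm -subr_eq0 opprD addNKr oppr_eq0 psumr_eq0; last first.
  by move=> i _; exact: wt_exp_mnm_ge0.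
have E i : ((Lw (rshift N i) - om * (a i)%:R) * (m (rshift N i))%:R == 0) =
    leading i || (m (rshift N i) == 0%N).
  by rewrite mulf_eq0 subr_eq0 pnatr_eq0 eq_sym.
apply/allP/forallP => [H i|H i _] /=; first by rewrite -E; apply: H; rewrite mem_index_enum.
by rewrite E.
Qed.

Lemma mselect_exp_subst (b : pred 'X_{1..N + 1}) (p : {mpoly K[N + N]}) :
  mselect b (exp_subst A p) = exp_subst A (mselect (fun m => b (exp_mnm A m)) p).
Proof.
elim/mpolyind: p => [|c m p _ _ IH]; first by rewrite exp_subst0 !mselect0 exp_subst0.
rewrite exp_substD !mselectD exp_substD IH; congr (_ + _).
rewrite exp_substZ exp_substX !mselectZ exp_substZ !mselectX.
by case: ifP => _; rewrite ?exp_substX ?exp_subst0.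
Qed.

Lemma mselect_t_mderiv (b : pred 'X_{1..N + 1}) (f : T) :
  mselect b (t * f^`M(tvar)) = t * (mselect b f)^`M(tvar).
Proof.
have tX m : t * ('X_[m])^`M(tvar) = (m tvar)%:R *: 'X_[m].
  rewrite mderivX -scalerAr -mpolyXD; have [->|m0] := posnP (m tvar).
    by rewrite !scale0r.
  by rewrite addmC submK // lep1mP -lt0n.
elim/mpolyind: f => [|c m f _ _ IH]; first by rewrite mselect0 mderiv0 mulr0 mselect0.
rewrite mderivD mulrDr !mselectD IH mderivD mulrDr; congr (_ + _).
rewrite mderivZ -scalerAr tX !mselectZ !mselectX mderivZ -scalerAr.
by case: ifP; rewrite ?tX // mderiv0 mulr0 scaler0.
Qed.

Definition phase_mnm i : 'X_{1..N + 1} := (U_(lshift 1 i) + U_(tvar) *+ a i)%MM.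

Lemma phase_mnmX i : x i * t ^+ a i = 'X_[phase_mnm i].
Proof. by rewrite mpolyXD mpolyXn. Qed.

Lemma wt_phase_mnm i :
  s - wt ew (phase_mnm i) = Lw (rshift N i) - om * (a i)%:R.
Proof.
rewrite wtD wt_mul1 -[U_(lshift 1 i)%MM]mulm1n wt_mul1 mulr1 /ew.
rewrite (unsplitK (inl i)) (unsplitK (inr ord0)).
by rewrite opprD addrA; congr (_ - _); apply/eqP; rewrite subr_eq addrC Lw_lr.
Qed.

Lemma leading_dphase_neq0 : (exists2 i, leading i & (0 < a i)%N) -> leading_dphase != 0.
Proof.
move=> [e le_e ae]; apply/eqP => /(congr1 (mcoeff (phase_mnm e))).
rewrite /leading_dphase raddf_sum (bigD1 e) //= big1 => [|i /andP[_ ie]].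
  rewrite mulr_natl phase_mnmX mcoeffMn mcoeffX eqxx mcoeff0 addr0.
  by move/eqP; rewrite pnatr_eq0 eqn0Ngt ae.
rewrite mulr_natl phase_mnmX mcoeffMn mcoeffX; case: eqP => [|_]; last by rewrite mul0rn.
move/(congr1 (fun m : 'X_{1..N + 1} => m (lshift 1 i))); rewrite !mnmDE !mulmnE !mnm1E.
by rewrite !eq_lshift !eq_rlshift eqxx eq_sym (negbTE ie).
Qed.

Variable beta : K.

(** The variable [x_i] and the operator [d_i] have total weight [s], so that the leading
    terms of [t * dh/dt] have weight [s]; all other terms of [euler_op] raise the
    weight by less. *)
Lemma top_euler_op f c : {in msupp f, forall m, wt ew m <= c} ->
  mselect (fun m => wt ew m == c + s) (euler_op A beta f) =
  leading_dphase * mselect (fun m => wt ew m == c) f.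
Proof.
move=> fc.
have f0 d : c < d -> mselect (fun m => wt ew m == d) f = 0.
  by move=> cd; apply: mselect_eq0 => m /fc mc; rewrite lt_eqF // (le_lt_trans mc).
have cs : c < c + s by rewrite ltrDl.
rewrite /euler_op mul_mpolyC mselectB mselectD mselectZ mselect_t_mderiv !(f0 _ cs).
rewrite mderiv0 mulr0 scaler0 addr0 subr0 /dphase mulr_suml mselect_sum.
rewrite (bigID leading) /= [X in _ + X]big1 ?addr0 => [|i nle_i].
  rewrite mulr_suml; apply: eq_bigr => i /eqP le_i; rewrite phase_mnmX -!mulrA !mulr_natl.
  rewrite mselectMn mselectMX; congr (_ * _ *+ _).
  apply: eq_mselect => m _; rewrite wtD.
  have /eqP := wt_phase_mnm i; rewrite -le_i subrr subr_eq0 => /eqP <-.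
  by rewrite addrC (inj_eq (addIr s)).
rewrite phase_mnmX -mulrA mulr_natl mselectMn mselectMX.
rewrite (_ : mselect _ f = 0) ?mulr0 ?mul0rn // -[RHS](f0 (c + s - wt ew (phase_mnm i))).
  by apply: eq_mselect => m _; rewrite wtD [RHS]eq_sym subr_eq eq_sym [wt _ m + _]addrC.
rewrite -addrA wt_phase_mnm ltrDl subr_gt0 lt_neqAle om_le andbT.
exact: nle_i.
Qed.

(** The geometric input: the substitution [xi_i := t ^+ a_i] for leading [i],
    [xi_i := 0] for the others, sends the top weight part of an element of the GKZ
    ideal to a multiple of the leading part of [t * dh/dt].  Non-leading [xi_i] can be
    set to zero because they lose weight in the substitution. *)
Theorem leading_dphase_dvd P W : (exists2 i, leading i & (0 < a i)%N) ->
    GKZ_ideal A beta P -> {in msupp (symb P), forall m, wt Lw m <= W} ->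
  exists f, exp_subst A (mselect (fun m => leading_mnm m && (wt Lw m == W)) (symb P)) =
    leading_dphase * f.
Proof.
move=> lead_ex /exp_subst_GKZ[f]; move: (symb P) => p Pf pW.
rewrite (_ : mselect _ p = mselect (fun m => wt ew (exp_mnm A m) == W) p); last first.
  apply: eq_mselect => m mp; rewrite -wt_exp_mnm_eq.
  have [mW|ne] := eqVneq (wt Lw m) W; first by rewrite mW andbT.
  rewrite andbF; apply/esym/negP => /eqP eW; case/eqP: ne.
  by apply/le_anti; rewrite pW //= -eW wt_exp_mnm_le.
rewrite -(mselect_exp_subst (fun m => wt ew m == W)) Pf.
have fW : {in msupp f, forall m, wt ew m <= W - s}.
  have [->|f0] := eqVneq f 0; first by move=> m; rewrite msupp0.
  have [m1 m1f m1max] : exists2 m1, m1 \in msupp f & {in msupp f, forall m, wt ew m <= wt ew m1}.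
    by apply: exists_max_seq; rewrite msupp_eq0.
  suff le_m1 : wt ew m1 <= W - s by move=> m /m1max/le_trans->.
  rewrite leNgt; apply/negP => lt_m1.
  have := top_euler_op m1max; rewrite -Pf mselect_exp_subst (_ : mselect _ p = 0); last first.
    apply: mselect_eq0 => m mp; rewrite lt_eqF // (le_lt_trans (wt_exp_mnm_le m)) //.
    by rewrite (le_lt_trans (pW _ mp)) // -ltrBlDr.
  rewrite exp_subst0 => /esym/eqP; rewrite mulf_eq0 (negbTE (leading_dphase_neq0 lead_ex)) /=.
  move/eqP/(congr1 (mcoeff m1)); rewrite mcoeff_mselect eqxx mcoeff0 => /eqP.
  by rewrite mcoeff_eq0 m1f.
exists (mselect (fun m => wt ew m == W - s) f).
by rewrite -(top_euler_op fW) subrK.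
Qed.

End GradedParametrization.

(** * Ideals of the germ ring *)

Section Germs.
Variables (R : realType) (n : nat).
Local Notation C := R[i].
Local Notation N := n.+1.
Local Notation B := (germ_ring R n).
Implicit Types (Z : pred 'I_(N + N)) (f g : B) (q : {mpoly C[N + N]}).

HB.instance Definition _ := GRing.RMorphism.copy (@to_germ R n)
  (mmap (@mpolyC (1 + N) (cseries n C) \o (@cpoly n C \o @mpolyC n C)) (@germ_of_var R n)).

Lemma to_germX m : to_germ ('X_[m] : {mpoly C[N + N]}) = mmap1 (@germ_of_var R n) m.
Proof. exact: (@mmapX _ _ _ _ (@mpolyC (1 + N) (cseries n C) \o (@cpoly n C \o @mpolyC n C))). Qed.

Lemma to_germXU i : to_germ ('X_i : {mpoly C[N + N]}) = germ_of_var R i.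
Proof. by rewrite to_germX mmap1U. Qed.

Lemma to_germC c : to_germ (c%:MP : {mpoly C[N + N]}) = (cpoly c%:MP)%:MP.
Proof. exact: (@mmapC _ _ _ _ (@mpolyC (1 + N) (cseries n C) \o (@cpoly n C \o @mpolyC n C))). Qed.

Lemma germ_of_var_r j : germ_of_var R (rshift N j) = 'X_(rshift 1 j) :> B.
Proof. by rewrite /germ_of_var (unsplitK (inr j)). Qed.

Lemma germ_of_var_max : germ_of_var R (lshift N ord_max) = 'X_(lshift N ord0) :> B.
Proof. by rewrite /germ_of_var (unsplitK (inl ord_max)) unlift_none. Qed.

Lemma germ_of_var_l k :
  germ_of_var R (lshift N (lift ord_max k)) = (cpoly 'X_k)%:MP :> B.
Proof. by rewrite /germ_of_var (unsplitK (inl _)) liftK. Qed.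

Section Sigma.
Variables (p q : R) (I : set (weyl N C)).

Lemma sigma_ideal : left_ideal (sigma p q I).
Proof. exact: ideal_gen_ideal. Qed.

Lemma mem_sigma P : I P -> P != 0 -> sigma p q I (to_germ (initial_form p q P)).
Proof.
move=> IP P0; apply: sub_ideal_gen; exists (initial_form p q P) => //.
by apply: sub_ideal_gen; exists P.
Qed.

Lemma sigma_sub (J : set B) : left_ideal J ->
  (forall P, I P -> P != 0 -> J (to_germ (initial_form p q P))) ->
  (sigma p q I `<=` J)%classic.
Proof.
move=> idJ JP; apply: (ideal_gen_sub idJ) => _ [r + <-].
pose J' := [set r | J (to_germ r)]%classic; suff idJ' : left_ideal J'.
  by apply: (ideal_gen_sub idJ') => _ [P [IP P0] <-]; exact: JP.
have [J0 JD JM] := idJ; split=> [|u v|u v]; rewrite /J' /= ?rmorph0 ?rmorphD ?rmorphM //.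
  exact: JD.
exact: JM.
Qed.

End Sigma.

Section Vanishing.
Variable Z : pred 'I_(N + N).

Definition Zseries : pred 'I_n := fun k => Z (lshift N (lift ord_max k)).
Definition Zpoly : pred 'I_(1 + N) := fun i => Z (var_of_germ i).

Definition series_vanishing : set (cseries n C) :=
  [set g | coef_in Zseries [set 0] g]%classic.

(** The ideal of the germ ring generated by the variables in [Z], described by
    the coefficients of its elements. *)
Definition vanishing : set B :=
  [set f | coef_in Zpoly series_vanishing (fun m => f@_m)]%classic.

Lemma zero_ideal (S : comNzRingType) : left_ideal ([set 0]%classic : set S).
Proof. by split=> [|a b -> ->|a b ->]; rewrite /= ?addr0 ?mulr0. Qed.

Lemma series_vanishing_ideal : left_ideal series_vanishing.
Proof.
split=> [m _|a b va vb m avm|a b vb].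
- exact: cseries0E.
- by suff: a m + b m = 0 by []; rewrite (va _ avm) (vb _ avm) addr0.
- by rewrite /series_vanishing /=; apply: coef_in_cauchy => //; exact: zero_ideal.
Qed.

Lemma series_vanishing_prime a b :
  series_vanishing (a * b) -> series_vanishing a \/ series_vanishing b.
Proof.
apply: coef_in_prime => [|c d /eqP]; first exact: zero_ideal.
by rewrite mulf_eq0 => /orP[]/eqP; [left|right].
Qed.

Lemma mcoeff_cauchy f g : (fun m => (f * g)@_m) = cauchy (fun m => f@_m) (fun m => g@_m).
Proof. by apply/funext => m; rewrite mcoeffM. Qed.

Lemma vanishing_ideal : left_ideal vanishing.
Proof.
have [V0 VD VM] := series_vanishing_ideal.
split=> [m _|f g vf vg m avm|f g vg] /=.
- by rewrite mcoeff0.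
- by rewrite mcoeffD; apply: VD; [exact: vf|exact: vg].
- by rewrite /vanishing /= mcoeff_cauchy; apply: coef_in_cauchy.
Qed.

Lemma vanishing_radical f : radical vanishing f -> vanishing f.
Proof.
apply: radical_prime => [v1|a b].
  have := v1 _ (avoids0 _) _ (avoids0 _).
  by rewrite mcoeff1 eqxx cseries1E eqxx => /eqP; rewrite oner_eq0.
rewrite /vanishing /= mcoeff_cauchy; apply: coef_in_prime.
  exact: series_vanishing_ideal.
exact: series_vanishing_prime.
Qed.

Lemma vanishing_var i : Z i -> vanishing (germ_of_var R i).
Proof.
move=> Zi m avm a ava; case: (split_ordP i) Zi => j ->; last first.
  rewrite germ_of_var_r => Zj; rewrite mcoeffX.
  case: eqP avm => [<-|_ _]; last exact: cseries0E.
  rewrite (@avoidsN _ _ _ (rshift 1 j)) ?mnm1E ?eqxx //.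
  by rewrite /Zpoly /var_of_germ (unsplitK (inr j)).
case: (unliftP ord_max j) => [k|] ->; last first.
  rewrite germ_of_var_max => Zj; rewrite mcoeffX.
  case: eqP avm => [<-|_ _]; last exact: cseries0E.
  rewrite (@avoidsN _ _ _ (lshift N ord0)) ?mnm1E ?eqxx //.
  by rewrite /Zpoly /var_of_germ (unsplitK (inl ord0)).
rewrite germ_of_var_l => Zj; rewrite mcoeffC.
case: eqP => _; last by rewrite mulr0; exact: cseries0E.
rewrite mulr1 /= mcoeffX; case: eqP ava => // <-.
by rewrite (@avoidsN _ _ _ k) ?mnm1E ?eqxx.
Qed.

Lemma vanishing_to_germ q : {in msupp q, forall m, ~~ avoids Z m} ->
  vanishing (to_germ q).
Proof.
move=> qZ; rewrite [q]mpolyE raddf_sum /=.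
apply: ideal_sum_seq => [|m /qZ/avoidsPn [i Zi mi]]; first exact: vanishing_ideal.
rewrite -mul_mpolyC rmorphM; have [_ _ VM] := vanishing_ideal; apply: (VM).
rewrite -(submK (m := U_(i)%MM) (m' := m)) ?lep1mP -?lt0n // mpolyXD rmorphM.
by apply: VM; rewrite /= to_germXU; exact: vanishing_var.
Qed.

End Vanishing.

End Germs.

(** * Binomials, the Euler operator and leading coefficients *)

Section Members.
Variables (K : comNzRingType) (n : nat) (A : n.-tuple nat) (beta : K).
Local Notation a := (tnth A).

Definition binomial_op i j : weyl n K := diffop ('X_i ^+ a j - 'X_j ^+ a i).

Lemma GKZ_binomial_op i j : GKZ_ideal A beta (binomial_op i j).
Proof.
move=> J [_ GJ]; apply: GJ; left; exists ('X_i ^+ a j - 'X_j ^+ a i) => // I [_ GI]; apply: GI.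
exists (U_(i) *+ a j)%MM, (U_(j) *+ a i)%MM; split; last by rewrite !mpolyXn.
have E k e : Adeg A (U_(k) *+ e)%MM = (a k * e)%N.
  rewrite /Adeg (bigD1 k) //= mulmnE mnm1E eqxx mul1n big1 ?addn0 // => l lk.
  by rewrite mulmnE mnm1E eq_sym (negbTE lk) muln0.
by rewrite !E mulnC.
Qed.

Lemma symb_binomial_op i j :
  symb (binomial_op i j) = 'X_(rshift n i) ^+ a j - 'X_(rshift n j) ^+ a i.
Proof. by rewrite symb_diffop rmorphB !rmorphXn /= !mmapX !mmap1U. Qed.

Lemma GKZ_euler : GKZ_ideal A beta (euler A beta).
Proof. by move=> J [_ GJ]; apply: GJ; right. Qed.

End Members.

Section LeadingCoefficients.
Variables (R : realType) (K : numFieldType) (n : nat) (A : n.+1.-tuple nat) (s om : R).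
Local Notation N := n.+1.
Local Notation a := (tnth A).
Local Notation leading_mnm := (leading_mnm A s om).
Implicit Types (q : {mpoly K[N + N]}) (m : 'X_{1..N + N}).

(** A zero of the leading part of [t * dh/dt]: the point [x = 0], [t = 1]. *)
Definition unit_point (i : 'I_(N + 1)) : K := match split i with inl _ => 0 | inr _ => 1 end.

Lemma meval_leading_dphase : (leading_dphase K A s om).@[unit_point] = 0.
Proof.
rewrite /leading_dphase rmorph_sum big1 // => i _.
by rewrite !rmorphM /= mevalXU /unit_point (unsplitK (inl i)) mul0r mulr0.
Qed.

Lemma meval_exp_mnm m :
  ('X_[exp_mnm A m] : {mpoly K[N + 1]}).@[unit_point] =
  \prod_(i < N) 0 ^+ m (lshift N i).
Proof.
rewrite mevalX big_split_ord big_ord1 /= [X in _ * X](_ : _ = 1) ?mulr1.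
  by apply: eq_bigr => i _; rewrite /unit_point (unsplitK (inl i)) exp_mnml.
by rewrite /unit_point (unsplitK (inr ord0)) expr1n.
Qed.

Lemma prod_leading_mnm m :
  \prod_(i < N) (leading A s om i)%:R ^+ m (rshift N i) = (leading_mnm m)%:R :> K.
Proof.
have [/forallP lm|] := boolP (leading_mnm m).
  rewrite big1 // => i _; have := lm i.
  by case: (leading _ _ _ _) => /= [_|/eqP->]; rewrite ?expr1n ?expr0.
move=> /forallPn [j]; rewrite negb_or -lt0n => /andP[/negbTE lj mj].
by rewrite (bigD1 j) //= lj expr0n eqn0Ngt mj mul0r.
Qed.

Lemma mcoeff_mulX_eq0 k (S : comNzRingType) (u v : 'X_{1..k}) (f : {mpoly S[k]}) i :
  (v i < u i)%N -> ('X_[u] * f)@_v = 0.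
Proof.
move=> lt_vu; rewrite mcoeffM big1 // => -[[w ltw] [w' ltw']] /= /eqP vE.
rewrite mcoeffX; case: eqP => [uw|]; last by rewrite mul0r.
by move: lt_vu; rewrite {1}vE uw mnmDE ltnNge leq_addr.
Qed.

Variable e : 'I_N.
Hypothesis leadingE : forall i, leading A s om i = (i == e).
Hypothesis ae : (0 < a e)%N.

(** When only [e] is leading, the substitution is injective on leading monomials,
    so that coefficients can be read off. *)
Lemma mcoeff_exp_subst q m : leading_mnm m ->
  (exp_subst A (mselect leading_mnm q))@_(exp_mnm A m) = q@_m.
Proof.
have r0 m' i : leading_mnm m' -> i != e -> m' (rshift N i) = 0%N.
  by move=> /forallP/(_ i); rewrite leadingE => /orP[->//|/eqP].
have tE m' : leading_mnm m' -> exp_mnm A m' (rshift N ord0) = (a e * m' (rshift N e))%N.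
  move=> lm'; rewrite exp_mnmr (bigD1 e) //= big1 ?addn0 // => k ke.
  by rewrite r0 ?muln0.
move=> lm; elim/mpolyind: q => [|c m' q _ _ IH].
  by rewrite mselect0 exp_subst0 !mcoeff0.
rewrite mselectD exp_substD !mcoeffD IH; congr (_ + _).
rewrite mselectZ exp_substZ !mcoeffZ mselectX mcoeffX; congr (_ * _).
have [eq_m|ne] := eqVneq m' m; first by rewrite eq_m lm exp_substX mcoeffX eqxx.
case: ifP => lm'; last by rewrite exp_subst0 mcoeff0.
rewrite exp_substX mcoeffX; case: eqP => // E; case/eqP: ne.
apply/mnmP => i; case: (split_ordP i) => j ->.
  by have := congr1 (fun u : 'X_{1..N + 1} => u (lshift 1 j)) E; rewrite !exp_mnml.
have [->|je] := eqVneq j e; last by rewrite !r0.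
have := congr1 (fun u : 'X_{1..N + 1} => u (rshift N ord0)) E.
by rewrite !tE // => /eqP; rewrite eqn_pmul2l // => /eqP.
Qed.

(** A multiple of [x_e * t ^ a_e] has no coefficient at a monomial without [x_e]
    or without [t]. *)
Lemma mcoeff_leading q f m :
    exp_subst A (mselect leading_mnm q) = leading_dphase K A s om * f ->
    leading_mnm m -> (m (lshift N e) == 0%N) || (m (rshift N e) == 0%N) ->
  q@_m = 0.
Proof.
move=> qf lm m0; rewrite -(mcoeff_exp_subst q lm) qf /leading_dphase.
rewrite (eq_bigl _ _ leadingE) big_pred1_eq phase_mnmX mulr_natl mulrnAl mcoeffMn.
case/orP: m0 => /eqP m0.
  rewrite (@mcoeff_mulX_eq0 _ _ _ _ _ (lshift 1 e)) ?mul0rn // exp_mnml m0.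
  by rewrite mnmDE mulmnE !mnm1E eqxx.
rewrite (@mcoeff_mulX_eq0 _ _ _ _ _ (rshift N ord0)) ?mul0rn // exp_mnmr.
rewrite (bigD1 e) //= m0 muln0 big1 => [|i ie].
  by rewrite mnmDE mulmnE !mnm1E eq_lrshift eqxx mul1n.
by move: lm => /forallP/(_ i); rewrite leadingE (negbTE ie) /= => /eqP->; rewrite muln0.
Qed.

End LeadingCoefficients.

(** * Elements of the radical *)

Section InitialForms.
Variables (R : realType) (n : nat) (A : n.+1.-tuple nat) (s om : R) (beta : R[i]).
Local Notation C := R[i].
Local Notation N := n.+1.
Local Notation a := (tnth A).
Local Notation leading := (leading A s om).
Local Notation leading_mnm := (leading_mnm A s om).
Local Notation H := (GKZ_ideal A beta).
Local Notation J := (radical (sigma s 1 H)).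
Local Notation xi i := ('X_(rshift 1 i) : germ_ring R n).

Hypothesis s0 : 0 < s.
Hypothesis om_le : forall i, om * (a i)%:R <= Lw s (rshift N i).
Hypothesis a0 : forall i, (0 < a i)%N.

Lemma initial_form_neq0 (P : weyl N C) : initial_form s 1 P != 0 -> P != 0.
Proof. by apply: contra_neq => ->; rewrite /initial_form /= msupp0 big_nil. Qed.

Lemma leading_initial_form P : (exists i, leading i) -> H P -> P != 0 ->
  exists f, exp_subst A (mselect leading_mnm (initial_form s 1 P)) =
            leading_dphase C A s om * f.
Proof.
move=> [e le_e] HP P0.
have [m0 m0P m0max] : exists2 m0, m0 \in msupp (symb P) &
    {in msupp (symb P), forall m, wt (Lw s) m <= wt (Lw s) m0}.
  apply: exists_max_seq; rewrite msupp_eq0; apply: contra_neq P0 => P0.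
  exact: val_inj.
have lead_ex : exists2 i, leading i & (0 < a i)%N by exists e.
have [f fE] := leading_dphase_dvd s0 om_le lead_ex HP m0max.
exists f; rewrite -fE; congr (exp_subst A _); apply/mpolyP => m.
rewrite !mcoeff_mselect.
have [mP|/memN_msupp_eq0->] := boolP (m \in msupp (symb P)); last by rewrite !if_same.
have -> : all (fun m' => Lweight s 1 m' <= Lweight s 1 m) (msupp (symb P)) =
    (wt (Lw s) m == wt (Lw s) m0).
  apply/allP/eqP => [mmax|mW m' m'P]; last by rewrite !Lweight_wt mW m0max.
  by apply/le_anti; rewrite m0max //= -!Lweight_wt mmax.
by case: (leading_mnm m).
Qed.

Lemma rad_ideal : left_ideal J.
Proof. exact/radical_ideal/sigma_ideal. Qed.

Lemma mem_rad P : H P -> initial_form s 1 P != 0 -> J (to_germ (initial_form s 1 P)).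
Proof.
by move=> HP P0; apply: sub_radical; exact: (mem_sigma HP (initial_form_neq0 P0)).
Qed.

Lemma mpolyXn_neq0 (i : 'I_(N + N)) k : ('X_i ^+ k : {mpoly C[N + N]}) != 0.
Proof. by rewrite mpolyXn -msupp_eq0 msuppX. Qed.

Lemma wt_Xn (i : 'I_(N + N)) k :
  {in msupp ('X_i ^+ k : {mpoly C[N + N]}), forall m, wt (Lw s) m = Lw s i * k%:R}.
Proof. by move=> m; rewrite mpolyXn msuppX inE => /eqP->; rewrite wt_mul1. Qed.

Lemma to_germ_xi i : to_germ ('X_(rshift N i) : {mpoly C[N + N]}) = xi i.
Proof. by rewrite to_germXU germ_of_var_r. Qed.

(** The initial form of [d_i ^ a_j - d_j ^ a_i] is [xi_i ^ a_j] when [j] is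
    leading and [i] is not. *)
Lemma rad_xi i : (exists j, leading j) -> ~~ leading i -> J (xi i).
Proof.
move=> [j /eqP le_j] nle_i; apply: (@radicalX _ _ _ (a j)).
have inE : initial_form s 1 (binomial_op C A i j) = 'X_(rshift N i) ^+ a j.
  apply: (initial_formE (q := - 'X_(rshift N j) ^+ a i) (W := Lw s (rshift N i) * (a j)%:R)).
  - exact: symb_binomial_op.
  - exact: mpolyXn_neq0.
  - exact: wt_Xn.
  - move=> m; rewrite (perm_mem (msuppN _)) => /wt_Xn->.
    rewrite -le_j mulrAC ltr_pM2r ?ltr0n // lt_neqAle om_le andbT.
    exact: nle_i.
rewrite -to_germ_xi -rmorphXn /= -inE; apply: mem_rad; first exact: GKZ_binomial_op.
by rewrite inE mpolyXn_neq0.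
Qed.

Lemma rad_natr k y : (0 < k)%N -> J (k%:R * y) -> J y.
Proof.
move=> k0 Jy; have [_ _ JM] := rad_ideal.
have -> : y = to_germ (k%:R^-1)%:MP * (k%:R * y).
  rewrite mulrA -(rmorph_nat (@to_germ R n)) -rmorphM -mpolyC_nat -mpolyCM /=.
  by rewrite mulVf ?pnatr_eq0 -?lt0n // mpolyC1 rmorph1 mul1r.
exact: JM.
Qed.

Definition euler_symbol : {mpoly C[N + N]} :=
  \sum_i (a i)%:R * ('X_(lshift N i) * 'X_(rshift N i)).

Definition euler_mnm i : 'X_{1..N + N} := (U_(lshift N i) + U_(rshift N i))%MM.

Lemma mcoeff_euler_symbol m :
  euler_symbol@_m = \sum_i (euler_mnm i == m)%:R *+ a i.
Proof.
rewrite /euler_symbol raddf_sum; apply: eq_bigr => i _.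
by rewrite mulr_natl -mpolyXD /= mcoeffMn mcoeffX.
Qed.

Lemma euler_symbol_neq0 : euler_symbol != 0.
Proof.
apply/eqP => /(congr1 (mcoeff (euler_mnm ord0))); rewrite mcoeff0 mcoeff_euler_symbol.
rewrite (bigD1 ord0) //= eqxx big1 => [|i i0].
  by rewrite addr0 => /eqP; rewrite pnatr_eq0 eqn0Ngt a0.
case: eqP => [|_]; last by rewrite mul0rn.
move/(congr1 (fun m : 'X_{1..N + N} => m (lshift N i))); rewrite !mnmDE !mnm1E.
by rewrite !eq_lshift !eq_rlshift eqxx eq_sym (negbTE i0).
Qed.

Lemma in_euler : initial_form s 1 (euler A beta) = euler_symbol.
Proof.
apply: (initial_formE (q := - beta%:MP) (W := s)); first exact: symb_euler.
- exact: euler_symbol_neq0.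
- move=> m; rewrite mcoeff_msupp mcoeff_euler_symbol => m_neq0.
  have [i um] : exists i, euler_mnm i = m.
    apply: contrapT => num; case/eqP: m_neq0; apply: big1 => i _.
    by case: eqP => [um|]; rewrite ?mul0rn //; case: num; exists i.
  by rewrite -um wtD -[U_(lshift N i)%MM]mulm1n -[U_(rshift N i)%MM]mulm1n !wt_mul1 !mulr1 Lw_lr.
- move=> m; rewrite (perm_mem (msuppN _)) msuppC; case: ifP => // _.
  by rewrite inE => /eqP->; rewrite /wt big1 // => i _; rewrite mnm0E mulr0.
Qed.

Lemma to_germ_euler_symbol :
  to_germ euler_symbol = \sum_i (a i)%:R * (germ_of_var R (lshift N i) * xi i).
Proof.
rewrite /euler_symbol (rmorph_sum (@to_germ R n)); apply: eq_bigr => i _.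
by rewrite !rmorphM rmorph_nat /= !to_germXU germ_of_var_r.
Qed.

(** Modulo the non-leading [xi_i], only one term of the initial form of the Euler
    operator survives. *)
Lemma rad_x_xi e : (forall i, leading i = (i == e)) ->
  J (germ_of_var R (lshift N e) * xi e).
Proof.
move=> leadingE; apply: (rad_natr (a0 e)); have [_ _ JM] := rad_ideal.
have : J (to_germ (initial_form s 1 (euler A beta))).
  apply: mem_rad; first exact: GKZ_euler.
  by rewrite in_euler euler_symbol_neq0.
rewrite in_euler to_germ_euler_symbol (bigD1 e isT).
apply: (ideal_addKr rad_ideal).
apply: (ideal_sum _ rad_ideal) => i ie.
apply/JM/JM/rad_xi; first by exists e; rewrite leadingE.
by rewrite leadingE.
Qed.

End InitialForms.

(** * The union of the zero section and a conormal space *)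

Section TwoComponents.
Variables (R : realType) (n : nat) (e : 'I_n.+1).
Local Notation N := n.+1.
Local Notation B := (germ_ring R n).
Local Notation xi i := ('X_(rshift 1 i) : B).

(** The coordinates vanishing on the zero section, and those vanishing on the
    conormal space of the hyperplane [x_e = 0]. *)
Definition zero_section (i : 'I_(N + N)) := match split i with inl _ => false | inr _ => true end.
Definition conormal (i : 'I_(N + N)) := match split i with inl j => j == e | inr j => j != e end.

Lemma zero_section_r i : zero_section (rshift N i).
Proof. by rewrite /zero_section (unsplitK (inr i)). Qed.

Lemma zero_section_l i : zero_section (lshift N i) = false.
Proof. by rewrite /zero_section (unsplitK (inl i)). Qed.

Lemma conormal_r i : conormal (rshift N i) = (i != e).
Proof. by rewrite /conormal (unsplitK (inr i)). Qed.

Lemma conormal_l i : conormal (lshift N i) = (i == e).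
Proof. by rewrite /conormal (unsplitK (inl i)). Qed.

Lemma avoids_Zpoly (Z : pred 'I_(N + N)) (m : 'X_{1..1 + N}) :
  (Z (lshift N ord_max) -> m (lshift N ord0) = 0%N) ->
  (forall i, Z (rshift N i) -> m (rshift 1 i) = 0%N) ->
  avoids (Zpoly Z) m.
Proof.
move=> m0 mr; apply/forallP => i; apply/implyP; rewrite /Zpoly /var_of_germ.
case: (split_ordP i) => j ->.
  by rewrite [j]ord1 => /m0->.
by move=> /mr->.
Qed.

Lemma germ_monomialX (m : 'X_{1..1 + N}) (i : 'I_(1 + N)) : (0 < m i)%N ->
  'X_[m] = 'X_[m - U_(i)] * 'X_i :> B.
Proof. by move=> mi; rewrite -mpolyXD submK // lep1mP -lt0n. Qed.

Lemma cseries_neq0 (c : cseries n R[i]) : c != 0 -> exists k, c k <> 0.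
Proof.
move=> c0; apply: contrapT => nc; case/eqP: c0; apply: cseries_ext => k.
rewrite [RHS]cseries0E; apply: contrapT => ck; by apply: nc; exists k.
Qed.

Variable J : set B.
Hypothesis idJ : left_ideal J.
Hypothesis Jxi : forall i, i != e -> J (xi i).
Hypothesis Jxxi : J (germ_of_var R (lshift N e) * xi e).

(** A term of an element vanishing on both components is divisible by some [xi_i]
    with [i != e] or by [x_e * xi_e].  If [e] is not the last index then [x_e] is
    one of the variables of the coefficient series, which has to be divided. *)
Lemma components_sub (f : B) :
  vanishing zero_section f -> vanishing conormal f -> J f.
Proof.
move=> fz fc; have [_ _ JM] := idJ; rewrite [f]mpolyE.
apply: ideal_sum_seq => // m; rewrite mcoeff_msupp => fm0; rewrite -mul_mpolyC.
have [k fmk] := cseries_neq0 fm0.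
have [i /andP[ie mi]|m0] := pickP (fun i => (i != e) && (0 < m (rshift 1 i))%N).
  rewrite (germ_monomialX mi) mulrA; apply: JM.
  exact: Jxi.
have mr0 i : i != e -> m (rshift 1 i) = 0%N.
  by move=> ie; have := m0 i; rewrite ie /= lt0n => /negbFE/eqP.
have [me0|me0] := posnP (m (rshift 1 e)).
  case: fmk; apply: fz; last by apply/forallP => i; rewrite /Zseries zero_section_l.
  apply: avoids_Zpoly => [|i _]; first by rewrite zero_section_l.
  by have [->|/mr0] := eqVneq i e.
rewrite (germ_monomialX me0).
case: (unliftP ord_max e) => [j|] eE.
  have [c cE] : exists c, f@_m = cpoly 'X_j * c.
    apply: cseries_divX => b bj0; apply: fc.
      apply: avoids_Zpoly => [|i]; last by rewrite conormal_r => /mr0.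
      by rewrite conormal_l eE (negbTE (neq_lift _ _)).
    apply/forallP => i; rewrite /Zseries conormal_l eE; apply/implyP.
    by move=> /eqP/lift_inj->; rewrite bj0.
  have := Jxxi; rewrite cE {1}eE germ_of_var_l mpolyCM.
  move: (cpoly _)%:MP (c%:MP) 'X_[m - _] ('X_(rshift 1 e)) => u v g w Juw.
  have -> : u * v * (g * w) = (v * g) * (u * w) by ring.
  exact: JM.
have [x0|x0] := posnP (m (lshift N ord0)).
  case: fmk; apply: fc; last first.
    apply/forallP => i; rewrite /Zseries conormal_l eE.
    by rewrite eq_sym (negbTE (neq_lift _ _)).
  by apply: avoids_Zpoly => // i; rewrite conormal_r => /mr0.
rewrite (@germ_monomialX (m - _) (lshift N ord0)); last first.
  by rewrite mnmBE mnm1E eq_rlshift subn0.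
have := Jxxi; rewrite {1}eE germ_of_var_max.
move: ((f@_m)%:MP) 'X_[m - _ - _] ('X_(lshift N ord0)) ('X_(rshift 1 e)) => c h u w Juw.
have -> : c * (h * u * w) = c * h * (u * w) by ring.
exact: JM.
Qed.

End TwoComponents.

(** * One or two leading indices *)

Section Slopes.
Variables (R : realType) (n : nat) (A : n.+1.-tuple nat) (s om : R) (beta : R[i]).
Local Notation C := R[i].
Local Notation N := n.+1.
Local Notation B := (germ_ring R n).
Local Notation a := (tnth A).
Local Notation leading := (leading A s om).
Local Notation leading_mnm := (leading_mnm A s om).
Local Notation H := (GKZ_ideal A beta).
Local Notation J := (radical (sigma s 1 H)).
Local Notation xi i := ('X_(rshift 1 i) : B).

Hypothesis s0 : 0 < s.
Hypothesis om_le : forall i, om * (a i)%:R <= Lw s (rshift N i).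
Hypothesis a0 : forall i, (0 < a i)%N.

Lemma rad_sub_vanishing Z (f : B) :
  (forall P, H P -> P != 0 -> {in msupp (initial_form s 1 P), forall m, ~~ avoids Z m}) ->
  J f -> vanishing Z f.
Proof.
move=> HZ [k Jfk]; apply: vanishing_radical; exists k; move: Jfk.
apply: sigma_sub; first exact: vanishing_ideal.
by move=> P HP P0; apply/vanishing_to_germ/HZ.
Qed.

Lemma vanishing_homogeneous Z w : homogeneous w (@vanishing R n Z).
Proof.
move=> f d vf m avm; have [V0 _ _] := series_vanishing_ideal R Z.
rewrite -[homog_part w d f]/(mselect (fun m => wdeg w m == d) f) mcoeff_mselect.
by case: ifP => _; [exact: vf|exact: V0].
Qed.

(** The right-hand side is generated by [x_e * xi_e] and the [xi_i] with [i != e],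
    which lie in the radical.  Conversely, since the leading part of [t * dh/dt] is
    the single monomial [a_e * x_e * t ^ a_e], the monomials of an initial form that
    contain no [xi_i] with [i != e] are divisible by [x_e * xi_e]. *)
Lemma rad_one_leading e (f : B) : (forall i, leading i = (i == e)) ->
  J f <-> vanishing (@zero_section n) f /\ vanishing (conormal e) f.
Proof.
move=> leadingE; have lead_ex : exists i, leading i by exists e; rewrite leadingE.
split=> [Jf|[fz fc]]; last first.
  apply: (components_sub (rad_ideal _ _ _)) fz fc.
    by move=> i ie; apply: (rad_xi _ om_le) => //; rewrite leadingE.
  exact: (rad_x_xi beta s0 om_le).
split; apply: rad_sub_vanishing Jf => P HP P0 m; rewrite mcoeff_msupp => m_neq0;
    apply/negP => /forallP av; case/eqP: m_neq0;
    have [g gE] := leading_initial_form s0 om_le a0 lead_ex HP P0.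
  have m0 i : m (rshift N i) = 0%N by have := av (rshift N i); rewrite zero_section_r => /eqP.
  apply: (mcoeff_leading leadingE (a0 e) gE); last by rewrite m0 eqxx orbT.
  by apply/forallP => i; rewrite m0 eqxx orbT.
apply: (mcoeff_leading leadingE (a0 e) gE).
  by apply/forallP => i; have := av (rshift N i); rewrite conormal_r leadingE implyNb.
by have := av (lshift N e); rewrite conormal_l eqxx /= => ->.
Qed.

Lemma bihomogeneous_one_leading e : (forall i, leading i = (i == e)) -> bihomogeneous J.
Proof.
move=> leadingE; have JE f := rad_one_leading f leadingE.
by split=> f d /JE[fz fc]; apply/JE; split; apply: vanishing_homogeneous.
Qed.

Definition germ_point (i : 'I_(1 + N)) : C :=
  match split i with inl _ => 0 | inr j => (leading j)%:R end.

(** The evaluation at the image of the point [x = 0], [t = 1] under the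
    parametrization of the leading variables. *)
Definition germ_eval : B -> C := mmap (@cst_coef n C) germ_point.
HB.instance Definition _ := GRing.RMorphism.copy germ_eval (mmap (@cst_coef n C) germ_point).

Lemma germ_eval_xi i : germ_eval (xi i) = (leading i)%:R.
Proof. by rewrite /germ_eval mmapX mmap1U /germ_point (unsplitK (inr i)). Qed.

Lemma germ_eval_l i : germ_eval (germ_of_var R (lshift N i)) = 0.
Proof.
case: (unliftP ord_max i) => [k|] ->.
  by rewrite germ_of_var_l /germ_eval mmapC /cst_coef /= mcoeffX mnm1_eq0.
by rewrite germ_of_var_max /germ_eval mmapX mmap1U /germ_point (unsplitK (inl ord0)).
Qed.

Lemma germ_eval_to_germD p q :
  germ_eval (to_germ (p + q)) = germ_eval (to_germ p) + germ_eval (to_germ q).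
Proof. by rewrite (rmorphD (@to_germ R n)) (rmorphD germ_eval). Qed.

Lemma germ_eval_to_germZ c q :
  germ_eval (to_germ (c *: q)) = c * germ_eval (to_germ q).
Proof.
rewrite -mul_mpolyC (rmorphM (@to_germ R n)) (rmorphM germ_eval) /= to_germC.
by rewrite {1}/germ_eval mmapC /cst_coef /= mcoeffC eqxx mulr1.
Qed.

Lemma germ_eval_to_germX m :
  germ_eval (to_germ 'X_[m]) = (\prod_(i < N) 0 ^+ m (lshift N i)) * (leading_mnm m)%:R.
Proof.
rewrite to_germX /mmap1 (rmorph_prod germ_eval) big_split_ord /= -prod_leading_mnm.
congr (_ * _); apply: eq_bigr => j _; rewrite (rmorphXn germ_eval) /=.
  by rewrite germ_eval_l.
by rewrite germ_of_var_r germ_eval_xi.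
Qed.

Lemma germ_eval_to_germ q : germ_eval (to_germ q) =
  (exp_subst A (mselect leading_mnm q)).@[@unit_point C n].
Proof.
elim/mpolyind: q => [|c m q _ _ IH].
  by rewrite mselect0 exp_subst0 meval0 !rmorph0.
rewrite mselectD exp_substD mevalD germ_eval_to_germD; apply: (congr2 +%R _ IH).
rewrite mselectZ exp_substZ mevalZ germ_eval_to_germZ germ_eval_to_germX mselectX.
case: ifP => _; rewrite ?mulr1 ?mulr0.
  by rewrite exp_substX meval_exp_mnm.
by rewrite exp_subst0 meval0 mulr0.
Qed.

Lemma rad_germ_eval f : (exists i, leading i) -> J f -> germ_eval f = 0.
Proof.
move=> lead_ex [k Jfk]; apply/eqP; suff: germ_eval (f ^+ k) == 0.
  by rewrite rmorphXn expf_eq0 => /andP[].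
apply/eqP; pose I := [set g | germ_eval g = 0]%classic; suff: I (f ^+ k) by [].
move: Jfk; apply: sigma_sub => [|P HP P0].
  split=> [|g h|g h]; rewrite /I /= ?rmorph0 ?rmorphD ?rmorphM //=.
    by move=> -> ->; rewrite addr0.
  by move=> ->; rewrite mulr0.
have [g gE] := leading_initial_form s0 om_le a0 lead_ex HP P0.
by rewrite /I /= germ_eval_to_germ gE rmorphM /= meval_leading_dphase mul0r.
Qed.

(** If two indices [i] and [j] are leading, the initial form of
    [d_i ^ a_j - d_j ^ a_i] is its full symbol.  Its homogeneous part [xi_i ^ a_j]
    is not in the radical, because it does not vanish at the evaluation point. *)
Lemma not_bihomogeneous_two_leading i j :
  leading i -> leading j -> i != j -> a i != a j -> ~ bihomogeneous J.
Proof.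
move=> li lj ij aij [homF _].
have lead_ex : exists k, leading k by exists i.
pose p : {mpoly C[N + N]} := 'X_(rshift N i) ^+ a j - 'X_(rshift N j) ^+ a i.
have mE k l : (U_(rshift N k) *+ l)%MM (rshift N i) = ((k == i) * l)%N :> nat.
  by rewrite mulmnE mnm1E eq_rshift.
have p0 : p != 0.
  apply/eqP => /(congr1 (mcoeff (U_(rshift N i) *+ a j)%MM)).
  rewrite mcoeff0 mcoeffB !mpolyXn !mcoeffX eqxx.
  case: eqP => [/(congr1 (fun m : 'X_{1..N + N} => m (rshift N i)))|_].
    by rewrite !mE eqxx eq_sym (negbTE ij) mul1n; have := a0 j; lia.
  by rewrite subr0 => /eqP; rewrite oner_eq0.
have inE : initial_form s 1 (binomial_op C A i j) = p.
  apply: (initial_formE (q := 0) (W := om * (a i)%:R * (a j)%:R)) => //.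
  - by rewrite addr0 symb_binomial_op.
  - move=> m /msuppB_le; rewrite mem_cat => /orP[]/wt_Xn->; rewrite -?(eqP li) -?(eqP lj) //.
    by rewrite mulrAC.
  - by move=> m; rewrite msupp0.
have Jp : J (to_germ p).
  by rewrite -inE; apply: mem_rad; [exact: GKZ_binomial_op|rewrite inE].
have pE : to_germ p = 'X_[U_(rshift 1 i) *+ a j] - 'X_[U_(rshift 1 j) *+ a i].
  by rewrite /p rmorphB !rmorphXn /= !to_germ_xi !mpolyXn.
have degE k l : wdeg (@weightF n \o @var_of_germ n) (U_(rshift 1 k) *+ l)%MM = l%:Z.
  rewrite /wdeg (bigD1 (rshift 1 k)) //= big1 ?addr0 => [|i' ik].
    rewrite mulmnE mnm1E eqxx mul1n /var_of_germ (unsplitK (inr k)).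
    by rewrite /weightF (unsplitK (inr k)) mul1r.
  by rewrite mulmnE mnm1E eq_sym (negbTE ik) mulr0.
have := homF _ (a j)%:Z Jp; rewrite -[homog_part _ _ _]/(mselect _ _) pE mselectB.
rewrite !mselectX !degE eqxx.
rewrite eqz_nat (negbTE aij) subr0 => /(rad_germ_eval lead_ex).
rewrite -mpolyXn rmorphXn /= germ_eval_xi li expr1n => /eqP.
by rewrite oner_eq0.
Qed.

End Slopes.

(** * The slopes *)

Lemma sorted_tuple_lt n (A : n.-tuple nat) i j : sorted ltn A ->
  (i < j < n)%N -> (nth 0%N A i < nth 0%N A j)%N.
Proof.
move=> Asorted /andP[ij jn]; apply: (sorted_ltn_nth ltn_trans) => //; rewrite inE size_tuple //.
exact: ltn_trans jn.
Qed.

(** The critical value of [s = - r] is [a_(n-1) / (a_n - a_(n-1))]: it is the one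
    for which [d_(n-1)] and [d_n] have weights proportional to [a_(n-1)] and
    [a_n].  All other [d_i] have weight [s] and smaller [a_i], so that they are
    never leading. *)
Theorem slopes_monomial_curve (R : realType) (n : nat) (A : n.+1.-tuple nat)
    (beta : R[i]) : (0 < n)%N -> (0 < nth 0%N A 0)%N -> sorted ltn A ->
  geometric_slopes (GKZ_ideal A beta) =
  [set - ((nth 0%N A n.-1)%:R / ((nth 0%N A n)%:R - (nth 0%N A n.-1)%:R) : R)]%classic.
Proof.
move=> n0 A0 Asorted.
have a_lt := sorted_tuple_lt Asorted.
have tnthE (i : 'I_n.+1) : tnth A i = nth 0%N A i by rewrite (tnth_nth 0%N).
have a0 (i : 'I_n.+1) : (0 < tnth A i)%N.
  rewrite tnthE; case: (nat_of_ord i) (ltn_ord i) => // k kn.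
  by apply: leq_ltn_trans (a_lt 0%N k.+1 _).
pose i1 : 'I_n.+1 := inord n.-1; pose i2 : 'I_n.+1 := ord_max.
have i1E : i1 = n.-1 :> nat by rewrite inordK // ltnS leq_pred.
have i12 : i1 != i2 by rewrite -val_eqE /= i1E; apply/eqP; lia.
set x : R := (nth 0%N A n.-1)%:R; set y : R := (nth 0%N A n)%:R.
have x0 : 0 < x by rewrite ltr0n; have := a0 i1; rewrite tnthE i1E.
have xy : x < y by rewrite ltr_nat a_lt //; lia.
have a1 : (tnth A i1)%:R = x by rewrite tnthE i1E.
have a2 : (tnth A i2)%:R = y by rewrite tnthE.
have a_other i : i != i1 -> i != i2 -> (tnth A i)%:R < x.
  move=> ii1 ii2; rewrite ltr_nat tnthE a_lt //.
  move: ii1 ii2; rewrite -!val_eqE /= i1E => /eqP ii1 /eqP ii2.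
  by have := ltn_ord i; lia.
have w1 s : Lw s (rshift n.+1 i1) = s by rewrite Lw_r (negbTE i12) addr0.
have w2 s : Lw s (rshift n.+1 i2) = s + 1 by rewrite Lw_r eqxx.
have w_other s i : i != i2 -> Lw s (rshift n.+1 i) = s.
  by move=> /negbTE ii2; rewrite Lw_r ii2 addr0.
have y0 : 0 < y by apply: lt_trans xy.
have yx0 : 0 < y - x by rewrite subr_gt0.
have crit s : (s * y == (s + 1) * x) = (s == x / (y - x)).
  have yx_neq0 := lt0r_neq0 yx0; apply/eqP/eqP => [E|->]; last by field.
  by apply: (mulIf yx_neq0); rewrite divfK // mulrBr E; ring.
(* Up to the critical value, the weight of [t] is dictated by the index [n-1]. *)
have lead1 s : 0 < s -> s * y <= (s + 1) * x ->
    (forall i, s / x * (tnth A i)%:R <= Lw s (rshift n.+1 i)) /\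
    forall i, leading A s (s / x) i = (i == i1) || (i == i2) && (s * y == (s + 1) * x).
  move=> s0 sxy; rewrite /leading.
  have E i : s / x * (tnth A i)%:R = s * (tnth A i)%:R / x by rewrite mulrAC.
  split=> i; rewrite E.
    have [->|ii1] := eqVneq i i1; first by rewrite a1 w1 mulfK ?lt0r_neq0.
    have [->|ii2] := eqVneq i i2; first by rewrite a2 w2 ler_pdivrMr.
    by rewrite w_other // ler_pdivrMr // ler_pM2l // ltW // a_other.
  have [->|ii1] := eqVneq i i1; first by rewrite a1 w1 mulfK ?lt0r_neq0 ?eqxx.
  have [->|ii2] := eqVneq i i2.
    rewrite a2 w2 /= -(inj_eq (mulIf (lt0r_neq0 x0))) divfK ?lt0r_neq0 //.
  by rewrite w_other // lt_eqF // ltr_pdivrMr // ltr_pM2l // a_other.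
(* Beyond it, it is dictated by the last index. *)
have lead2 s : 0 < s -> (s + 1) * x < s * y ->
    (forall i, (s + 1) / y * (tnth A i)%:R <= Lw s (rshift n.+1 i)) /\
    forall i, leading A s ((s + 1) / y) i = (i == i2).
  move=> s0 sxy; rewrite /leading.
  have E i : (s + 1) / y * (tnth A i)%:R = (s + 1) * (tnth A i)%:R / y by rewrite mulrAC.
  have s1 : 0 < s + 1 by rewrite ltr_wpDr.
  have lt_other i : i != i2 -> (s + 1) / y * (tnth A i)%:R < Lw s (rshift n.+1 i).
    move=> ii2; rewrite E w_other // ltr_pdivrMr //; apply: le_lt_trans sxy.
    rewrite ler_pM2l //; have [->|ii1] := eqVneq i i1; first by rewrite a1.
    by rewrite ltW // a_other.
  split=> i; have [->|ii2] := eqVneq i i2.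
  - by rewrite E a2 w2 mulfK ?lt0r_neq0.
  - exact/ltW/lt_other.
  - by rewrite E a2 w2 mulfK ?lt0r_neq0 ?eqxx.
  - by rewrite lt_eqF // lt_other.
apply/seteqP; split=> [r [r0 nbih]|r ->] /=.
  have s0 : 0 < - r by rewrite oppr_gt0.
  apply/eqP; rewrite -eqr_oppLR -crit; apply: contra_notT nbih => ncrit.
  have [sxy|sxy] := leP (- r * y) ((- r + 1) * x).
    have [om_le leadE] := lead1 _ s0 sxy.
    apply: (bihomogeneous_one_leading beta s0 om_le a0 (e := i1)) => i.
    by rewrite leadE (negbTE ncrit) andbF orbF.
  have [om_le leadE] := lead2 _ s0 sxy.
  exact: (bihomogeneous_one_leading beta s0 om_le a0 leadE).
set s := x / (y - x); have s0 : 0 < s by rewrite divr_gt0.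
split; first by rewrite oppr_lt0.
have sxy : s * y == (s + 1) * x by rewrite crit.
have sxy_le : s * y <= (s + 1) * x by rewrite (eqP sxy).
rewrite opprK; have [om_le leadE] := lead1 _ s0 sxy_le.
have l1 : leading A s (s / x) i1 by rewrite leadE eqxx.
have l2 : leading A s (s / x) i2 by rewrite leadE eqxx sxy orbT.
have a12 : tnth A i1 != tnth A i2 by rewrite -(eqr_nat R) a1 a2 lt_eqF.
exact: (not_bihomogeneous_two_leading (beta := beta) s0 om_le a0 l1 l2 i12 a12).
Qed.

Theorem theorem4p4 (R : realType) (n : nat) (hn : (3 <= n.+1)%N)
    (A : n.+1.-tuple nat) (hA1 : tnth A ord0 = 1%N) (hA : sorted ltn A)
    (beta : R[i]) :
  geometric_slopes (GKZ_ideal A beta) =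
  geometric_slopes
    (GKZ_ideal [tuple 1%N; nth 0%N A n.-1; nth 0%N A n] beta).
Proof.
have A0 : nth 0%N A 0 = 1%N by rewrite -hA1 (tnth_nth 0).
have a_lt := sorted_tuple_lt hA.
rewrite slopes_monomial_curve ?A0 //; last lia.
rewrite slopes_monomial_curve //= andbT -A0.
by rewrite !a_lt //; lia.
Qed.
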